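(* Let $(X,C)$ be a strongly ordered separable Banach space. Let $\Phi:[0,\infty)\times X\to X$ be a $C^1$-smooth strongly monotone semiflow all of whose orbits have compact closure. Assume that for some fixed $t_0>0$ the Fréchet derivative $D\Phi_{t_0}(x)$ is a compact operator for every $x\in X$, and $D\Phi_{t_0}(e)$ is strongly positive for every equilibrium $e\in X$ (i.e. $D\Phi_{t_0}(e)v\gg0$ whenever $v>0$). Then the set $$S_\Phi:=\{x\in X:\ \lambda_{\max}(x,\Phi)>0\}$$ is shy in $X$. In particular, if $X=\mathbb{R}^d$, then $S_\Phi$ has Lebesgue measure zero in $\mathbb{R}^d$; hence $\Phi$ cannot have observable chaos.
   Context: Order: A cone $C$ in a Banach space $(X,\|\cdot\|)$ is a closed convex subset with $\lambda C\subset C$ for all $\lambda>0$ and $C\cap(-C)=\{0\}$. $(X,C)$ is a strongly ordered Banach space if $C$ has nonempty interior $\mathrm{Int}\,C$. Write $x\le y$ if $y-x\in C$, $x<y$ if $y-x\in C\setminus\{0\}$, $x\ll y$ if $y-x\in \mathrm{Int}\,C$ (reversed signs in the usual way). Semiflows: A semiflow $\Phi$ (continuous, $\Phi_0=\mathrm{id}$, $\Phi_{t+s}=\Phi_t\circ\Phi_s$ for $t,s\ge0$) is strongly monotone if $x<y$ implies $\Phi_t(x)\ll\Phi_t(y)$ for all $t>0$. The orbit of $x$ is $\{\Phi_t x:t\ge0\}$. An equilibrium is a point $e$ with $\Phi_t(e)=e$ for all $t\ge0$. $\Phi$ is $C^1$-smooth if the Fréchet derivative $D\Phi_t(x)$ with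 respect to the state variable $x$ exists for each $x\in X$, $t>0$, and $x\mapsto D\Phi_t(x)$ is continuous. Largest Lyapunov exponent: for a $C^1$-smooth semiflow $\Phi$ and $x\in X$, $$\lambda_{\max}(x,\Phi)=\liminf_{t\to+\infty}\frac{\log\|D\Phi_t(x)\|}{t},$$ with the convention $\log 0=-\infty$. Observable chaos: a $C^1$-smooth semiflow on a finite-dimensional space has observable chaos if $\lambda_{\max}(\cdot,\Phi)>0$ on a set of positive Lebesgue measure. Shyness: a Borel subset $W\subset X$ is shy if there is a nonzero finite compactly supported Borel measure $\mu$ on $X$ with $\mu(W+x)=0$ for every $x\in X$. *)

(* Defs.v *)
(* MathComp-Analysis *)
From HB Require Import structures.
From mathcomp Require Import all_boot all_order all_algebra.
From mathcomp Require Import all_classical all_reals all_analysis.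

Set Implicit Arguments.
Unset Strict Implicit.
Unset Printing Implicit Defensive.

Import Order.TTheory GRing.Theory Num.Theory.
Import numFieldNormedType.Exports.

Local Open Scope classical_set_scope.
Local Open Scope ring_scope.

HB.instance Definition _ (R : realType) (m n : nat) :=
  Complete.on 'M[R]_(m, n).

Section Order.
Context {R : realType} {X : normedModType R}.
Implicit Types (C : set X) (x y : X).

Definition separable_space (T : topologicalType) : Prop :=
  exists2 D : set T, countable D & dense D.

Definition is_cone C : Prop :=
  [/\ closed C,
      convex_set (C : set (convex_lmodType X)),
      forall k : R, 0 < k -> [set k *: x | x in C] `<=` C &
      C `&` [set - x | x in C] = [set 0]].

Definition strongly_ordered C : Prop := is_cone C /\ C° !=set0.

Definition cone_lt C x y : Prop := (C `\ 0) (y - x).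

Definition cone_ll C x y : Prop := C° (y - x).

Definition strongly_positive C (L : X -> X) : Prop :=
  forall v, cone_lt C 0 v -> cone_ll C 0 (L v).

End Order.

Section Operators.
Context {R : realType} {X : normedModType R}.
Implicit Types L : X -> X.

(* Extended-real valued, so that it is meaningful for every map [L]; it is
   finite exactly when [L] is bounded on the closed unit ball. *)
Definition opnorm L : \bar R :=
  ereal_sup [set `|L v|%:E | v in [set v | `|v| <= 1]].

Definition compact_operator L : Prop :=
  precompact [set L v | v in [set v | `|v| <= 1]].

End Operators.

Section Semiflow.
Context {R : realType} {X : normedModType R}.
Implicit Types (C : set X) (x y e : X) (t s : R).

(* Time [0, +oo) is represented by the nonnegative elements of [R]: the values
   [Phi t x] for t < 0 are irrelevant. *)
Implicit Types Phi : R -> X -> X.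

Definition is_semiflow Phi : Prop :=
  [/\ {within [set p : R * X | 0 <= p.1], continuous (fun p => Phi p.1 p.2)},
      forall x, Phi 0 x = x &
      forall t s x, 0 <= t -> 0 <= s -> Phi (t + s) x = Phi t (Phi s x)].

Definition strongly_monotone C Phi : Prop :=
  forall x y, cone_lt C x y ->
  forall t, 0 < t -> cone_ll C (Phi t x) (Phi t y).

Definition semiflow_orbit Phi x : set X := [set Phi t x | t in [set t | 0 <= t]].

Definition equilibrium Phi e : Prop := forall t, 0 <= t -> Phi t e = e.

(* ['d f x] is the Frechet derivative; its continuity in [x] is with respect to
   the operator norm. *)
Definition C1_smooth Phi : Prop :=
  forall t, 0 < t ->
    (forall x, differentiable (Phi t) x) /\
    (forall x, opnorm ('d (Phi t) y \- 'd (Phi t) x) @[y --> x] --> 0%E).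

(* [lne] is the extended logarithm, with [lne 0 = -oo]. *)
Definition lambda_max Phi x : \bar R :=
  limf_einf (fun t => (lne (opnorm ('d (Phi t) x)) / t%:E)%E) +oo%R.

Definition chaotic_set Phi : set X := [set x | (0 < lambda_max Phi x)%E].

End Semiflow.

Section Shy.
Context {R : realType} {X : normedModType R}.

Definition borel (W : set X) : Prop := (@open X).-sigma.-measurable W.

Definition shy (W : set X) : Prop :=
  borel W /\
  exists mu : {finite_measure set (g_sigma_algebraType (@open X)) -> \bar R},
    [/\ mu setT != 0%E,
        exists2 K : set X, compact K & mu (~` K) = 0%E &
        forall x : X, mu [set w + x | w in W] = 0%E].

End Shy.

Section Lebesgue.
Context {R : realType}.

Definition box d (a b : 'rV[R]_d) : set 'rV[R]_d :=
  [set x | forall i, a ord0 i <= x ord0 i <= b ord0 i].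

(* The maximum with 0 gives volume 0 to the empty boxes. *)
Definition box_volume d (a b : 'rV[R]_d) : R :=
  \prod_(i < d) Num.max 0 (b ord0 i - a ord0 i).

(* d-dimensional Lebesgue outer measure: covers by finitely or countably many
   boxes.  Lebesgue measure is its restriction to the sets that are measurable
   in the sense of Caratheodory; these include all sets of outer measure 0.
   The index set [D] makes the empty cover available when d = 0. *)
Definition lebesgue_outer d (A : set 'rV[R]_d) : \bar R :=
  ereal_inf [set v | exists (D : set nat) (a b : nat -> 'rV[R]_d),
    A `<=` \bigcup_(k in D) box (a k) (b k) /\
    v = (\esum_(k in D) (box_volume (a k) (b k))%:E)%E].

Definition lebesgue_measurable d : set (set 'rV[R]_d) :=
  caratheodory_measurable (@lebesgue_outer d).

Definition lebesgue_null d (A : set 'rV[R]_d) : Prop :=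
  lebesgue_measurable A /\ lebesgue_outer A = 0%E.

(* [f] is a linear coordinate system on the finite-dimensional space [X];
   [f = idfun] when [X] is ['rV[R]_d] itself. *)
Definition observable_chaos d (X : normedModType R)
    (f : {linear X -> 'rV[R]_d}) (Phi : R -> X -> X) : Prop :=
  exists A : set X,
    [/\ lebesgue_measurable (f @` A),
        (0 < lebesgue_outer (f @` A))%E &
        A `<=` chaotic_set Phi].

End Lebesgue.

(* Main.v *)
Require Import Defs.
From HB Require Import structures.
From mathcomp Require Import all_boot all_order all_algebra.
From mathcomp Require Import all_classical all_reals all_analysis.
From mathcomp Require Import measurable_realfun ring lra.

(* Fix [u] in the interior of the cone and countably many positive functionals
   [psi k] of norm at most 1 that separate points (Hahn-Banach applied to the
   distance to the cone).  Compactness of [D Phi_t0] along the relatively compact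
   orbit of [y] gives an Ehrling inequality
     |D Phi_t0 w| <= |w| / 2 + N * \sum_(k < N) |psi k (D Phi_t0 w)|,
   and, since [u] is interior, positivity bounds [psi k (D Phi_(n t0)(y) w)] by a
   multiple of [psi k (D Phi_(n t0)(y) u)].  Hence a positive Lyapunov exponent at
   [y] forces [psi k (D Phi_(n t0)(y) u)] to exceed [exp (n / m)] infinitely often,
   for some [k] and [m].  On the line [x + s u] this quantity is the derivative in
   [s] of the nondecreasing function [psi k (Phi_(n t0) (x + s u))], which stays
   bounded as [n] varies; Markov's inequality and the Borel-Cantelli lemma make
   the chaotic set null on every such line, hence shy.  In R^d the same estimate,
   summed over a grid of lines, bounds the Lebesgue outer measure. *)

Set Implicit Arguments.
Unset Strict Implicit.
Unset Printing Implicit Defensive.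

Import Order.TTheory GRing.Theory Num.Theory.
Import numFieldNormedType.Exports.

Local Open Scope classical_set_scope.
Local Open Scope ring_scope.

(** * Hahn-Banach theorem for sublinear functionals on a real vector space *)

Section HahnBanach.
Context {R : realType} {X : lmodType R}.
Implicit Types (p q : X -> R) (x y : X).

Definition sublinear q : Prop :=
  (forall x y, q (x + y) <= q x + q y) /\
  (forall (k : R) x, 0 < k -> q (k *: x) <= k * q x).

Lemma sublinear0 q : sublinear q -> q 0 = 0.
Proof.
move=> [_ qZ]; have := qZ 2 0; have := qZ 2^-1 0; rewrite !scaler0.
by rewrite invr_gt0 ltr0n => /(_ isT) + /(_ isT); lra.
Qed.

Lemma sublinearN q x : sublinear q -> - q (- x) <= q x.
Proof.
by move=> sq; have := sq.1 x (- x); rewrite subrr sublinear0//; lra.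
Qed.

(** For sublinear [q] the infimum is finite, being at least [- q (- x)]. The choice [t = 0] puts it
    below [q]; the choice [t = 1] bounds its value at [- y] by [- q y]. *)
Definition sublinear_shift q y x : R :=
  inf [set q (x + t *: y) - t * q y | t in [set t : R | 0 <= t]].

Let shift_lb q y x : sublinear q ->
  lbound [set q (x + t *: y) - t * q y | t in [set t : R | 0 <= t]] (- q (- x)).
Proof.
move=> sq _ [t /= t0 <-].
have := sq.1 (x + t *: y) (- x); rewrite addrAC subrr add0r.
move: t0; rewrite [0 <= t]le_eqVlt => /predU1P[<-|t0].
  by rewrite scale0r mul0r addr0 sublinear0//; lra.
have /(sq.2 _ (t *: y)) : 0 < t^-1 by rewrite invr_gt0.
rewrite scalerA mulVf ?gt_eqF// scale1r -(ler_pM2l t0) mulVKf ?gt_eqF//; lra.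
Qed.

Lemma sublinear_shift_le q y x (t : R) : sublinear q -> 0 <= t ->
  sublinear_shift q y x <= q (x + t *: y) - t * q y.
Proof.
move=> sq t0; apply: ge_inf; first by exists (- q (- x)); exact: shift_lb.
by exists t.
Qed.

Lemma sublinear_shift_ge q y x (c : R) : sublinear q ->
  (forall t, 0 <= t -> c <= q (x + t *: y) - t * q y) ->
  c <= sublinear_shift q y x.
Proof.
move=> sq cP; apply: lb_le_inf.
  by exists (q (x + 0 *: y) - 0 * q y), 0 => /=.
by move=> _ [t /= t0 <-]; exact: cP.
Qed.

Lemma sublinear_shift_sublinear q y : sublinear q ->
  sublinear (sublinear_shift q y).
Proof.
move=> sq; split=> [x x'|k x k0].
  rewrite -lerBlDr; apply: sublinear_shift_ge => // t t0.
  rewrite lerBlDr -lerBlDl; apply: sublinear_shift_ge => // t' t'0.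
  rewrite lerBlDl.
  apply: le_trans (sublinear_shift_le y (x + x') sq (addr_ge0 t0 t'0)) _.
  have := sq.1 (x + t *: y) (x' + t' *: y).
  rewrite addrACA -scalerDl mulrDl; lra.
rewrite -ler_pdivrMl//; apply: sublinear_shift_ge => // t t0.
rewrite ler_pdivrMl//.
apply: le_trans (sublinear_shift_le y _ sq (mulr_ge0 (ltW k0) t0)) _.
have := sq.2 k (x + t *: y) k0; rewrite scalerDr scalerA; lra.
Qed.

(* A minimal sublinear functional [q] is linear: its shift along [y] is
   sublinear, below [q], and at [- y] at most [- q y]. *)
Lemma minimal_sublinear_linear q : sublinear q ->
  (forall q', sublinear q' -> (forall x, q' x <= q x) -> q' = q) ->
  linear (q : X -> R^o).
Proof.
move=> sq qmin.
have qN y : q (- y) = - q y.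
  apply: le_anti; apply/andP; split; last first.
    by have := sublinearN (- y) sq; rewrite opprK.
  rewrite -{1}(qmin _ (sublinear_shift_sublinear y sq)).
    have := sublinear_shift_le y (- y) sq ler01.
    by rewrite scale1r addNr sublinear0// mul1r sub0r.
  move=> x; have := sublinear_shift_le y x sq (lexx 0).
  by rewrite scale0r mul0r addr0 subr0.
have qD x y : q (x + y) = q x + q y.
  apply: le_anti; rewrite sq.1 /=.
  by have := sq.1 (x + y) (- y); rewrite qN addrK; lra.
have qZ (k : R) x : 0 < k -> q (k *: x) = k * q x.
  move=> k0; apply: le_anti; rewrite sq.2//=.
  have /(sq.2 _ (k *: x)) : 0 < k^-1 by rewrite invr_gt0.
  by rewrite scalerA mulVf ?gt_eqF// scale1r -(ler_pM2l k0) mulVKf ?gt_eqF.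
move=> k x y; rewrite qD; congr (_ + _); rewrite -[RHS]/(k * q x).
have [k0|k0|->] := ltgtP k 0; last by rewrite scale0r mul0r sublinear0.
- rewrite -[k]opprK scaleNr qN qZ ?oppr_gt0//; lra.
- exact: qZ.
Qed.

(** Zorn's lemma for the reversed pointwise order: a nonempty chain is bounded by its pointwise
    infimum, which is finite because every sublinear [q] below [p] satisfies [- p (- x) <= q x]. *)
Lemma sublinear_minimal p : sublinear p ->
  exists q, [/\ sublinear q, (forall x, q x <= p x) &
  forall q', sublinear q' -> (forall x, q' x <= q x) -> q' = q].
Proof.
move=> sp; pose T := {q : X -> R | sublinear q /\ forall x, q x <= p x}.
pose le (s t : T) := `[< forall x, sval t x <= sval s x >].
have Tlb (t : T) x : - p (- x) <= sval t x.
  case: t => q /= [sq qp]; apply: le_trans (sublinearN x sq).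
  by rewrite lerN2.
have [|s t u /asboolP st /asboolP tu|s t /asboolP st /asboolP ts|A Atot|
    [q [sq qp]] qmax] := @Zorn T le; first by move=> s; apply/asboolP.
- by apply/asboolP => x; exact: le_trans (tu x) (st x).
- case: s t st ts => [s hs] [t ht] st ts.
  apply: eq_exist => /=; apply/funext => x.
  by apply: le_anti; rewrite ts st.
- have [->|/set0P[a Aa]] := eqVneq A set0.
    by exists (exist _ p (conj sp (fun x => lexx _))).
  pose V x := [set sval t x | t in A].
  have Vn x : V x !=set0 by exists (sval a x), a.
  have Vb x : has_lbound (V x) by exists (- p (- x)) => _ [t _ <-].
  have Vle t x : A t -> inf (V x) <= sval t x.
    by move=> At; apply: ge_inf => //; exists t.
  have sV : sublinear (fun x => inf (V x)).
    split=> [x y|k x k0].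
      (* Two members of the chain are comparable, so the smaller one serves at both [x] and [y]. *)
      rewrite -lerBlDr; apply: lb_le_inf => // _ [s As <-].
      rewrite lerBlDr -lerBlDl; apply: lb_le_inf => // _ [t At <-].
      rewrite lerBlDl; have [/asboolP st|/asboolP ts] := Atot _ _ As At.
        apply: le_trans (Vle _ _ At) _.
        apply: le_trans ((svalP t).1.1 x y) _.
        by rewrite lerD2r; exact: st.
      apply: le_trans (Vle _ _ As) _.
      apply: le_trans ((svalP s).1.1 x y) _.
      by rewrite lerD2l; exact: ts.
    rewrite -ler_pdivrMl//; apply: lb_le_inf => // _ [s As <-].
    rewrite ler_pdivrMl//; apply: le_trans (Vle _ _ As) _.
    exact: (svalP s).1.2.
  have Vp x : inf (V x) <= p x.
    by apply: le_trans (Vle _ x Aa) _; exact: (svalP a).2.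
  exists (exist _ (fun x => inf (V x)) (conj sV Vp)) => s As.
  by apply/asboolP => x /=; exact: Vle.
exists q; split=> // q' sq' q'q.
have q'p x : q' x <= p x by exact: le_trans (q'q x) (qp x).
by apply: (congr1 sval (qmax (exist _ q' (conj sq' q'p)) _)); exact/asboolP.
Qed.

(** Minimising below the shift of [p] along [x0], instead of below [p] itself, forces
    [f (- x0) <= - p x0], that is [p x0 <= f x0]. *)
Theorem hahn_banach p x0 : sublinear p ->
  exists f : {linear X -> R^o}, (forall x, f x <= p x) /\ f x0 = p x0.
Proof.
move=> sp; have [q [sq qp qmin]] :=
  sublinear_minimal (sublinear_shift_sublinear x0 sp).
have qlin := minimal_sublinear_linear sq qmin.
pose fM := GRing.isLinear.Build R X R^o _ (q : X -> R^o) qlin.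
pose f : {linear X -> R^o} := HB.pack (q : X -> R^o) fM.
have fp x : f x <= p x.
  apply: le_trans (qp x) _; have := sublinear_shift_le x0 x sp (lexx 0).
  by rewrite scale0r mul0r addr0 subr0.
exists f; split=> //; apply: le_anti; rewrite fp /=.
have /le_trans /(_ (sublinear_shift_le x0 (- x0) sp ler01)) := qp (- x0).
rewrite scale1r addNr sublinear0// mul1r sub0r.
have -> : q (- x0) = - f x0 by exact: (raddfN f x0).
by rewrite lerN2.
Qed.

End HahnBanach.

(** * Cones, the distance to a cone, and positive functionals that separate points *)

Section Cone.
Context {R : realType} {X : normedModType R}.
Implicit Types (C : set X) (x y : X).

Lemma cone0 C : is_cone C -> C 0.
Proof. by move=> [_ _ _ C0]; have [] : (C `&` [set - x | x in C]) 0 by rewrite C0. Qed.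

Lemma coneZ C (k : R) x : is_cone C -> 0 <= k -> C x -> C (k *: x).
Proof.
move=> cC; rewrite le_eqVlt => /predU1P[<- _|k0 Cx].
  by rewrite scale0r; exact: cone0.
by case: cC => _ _ /(_ k k0) CZ _; apply: CZ; exists x.
Qed.

Lemma coneD C x y : is_cone C -> C x -> C y -> C (x + y).
Proof.
move=> cC Cx Cy; have -> : x + y = 2 *: (2^-1 *: x + 2^-1 *: y).
  by rewrite scalerDr !scalerA divff// !scale1r.
apply: coneZ => //; case: cC => _ cvC _ _.
have h0 : (0 : R) <= 2^-1 by lra.
have h1 : (2^-1 : R) <= 1 by lra.
have /set_mem := cvC x y (Itv01 h0 h1) (mem_set Cx) (mem_set Cy).
have -> // : conv (Itv01 h0 h1) (x : convex_lmodType X) y = 2^-1 *: x + 2^-1 *: y.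
congr (_ + _ *: _); rewrite /unstable.onem/=; lra.
Qed.

Lemma cone_anti C x : is_cone C -> C x -> C (- x) -> x = 0.
Proof.
move=> [_ _ _ C0] Cx Cnx.
suff : (C `&` [set - x | x in C]) x by rewrite C0.
by split=> //; exists (- x) => //; rewrite opprK.
Qed.

Definition dist_to C y : R := inf [set `|y - c| | c in C].

Lemma dist_to_le C y c : C c -> dist_to C y <= `|y - c|.
Proof.
move=> Cc; apply: ge_inf; first by exists 0 => _ [z _ <-].
by exists c.
Qed.

Lemma dist_to_ge C y (r : R) : C !=set0 ->
  (forall c, C c -> r <= `|y - c|) -> r <= dist_to C y.
Proof.
move=> [c0 Cc0] rP; apply: lb_le_inf; first by exists `|y - c0|, c0.
by move=> _ [c Cc <-]; exact: rP.
Qed.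

Lemma dist_to_sublinear C : is_cone C -> sublinear (dist_to C).
Proof.
move=> cC; have C0 : C !=set0 by exists 0; exact: cone0.
split=> [x y|k x k0].
  rewrite -lerBlDr; apply: dist_to_ge => // c Cc.
  rewrite lerBlDr -lerBlDl; apply: dist_to_ge => // c' Cc'.
  rewrite lerBlDl; apply: le_trans (dist_to_le _ (coneD cC Cc Cc')) _.
  by rewrite opprD addrACA ler_normD.
rewrite -ler_pdivrMl//; apply: dist_to_ge => // c Cc.
rewrite ler_pdivrMl//.
apply: le_trans (dist_to_le _ (coneZ cC (ltW k0) Cc)) _.
by rewrite -scalerBr normrZ gtr0_norm.
Qed.

Lemma dist_to_gt0 C x : closed C -> C !=set0 -> ~ C x -> 0 < dist_to C x.
Proof.
move=> clC C0 nCx; have /nbhs_ballP[e /= e0 eC] : nbhs x (~` C).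
  by apply: open_nbhs_nbhs; split; [exact: closed_openC|].
apply: lt_le_trans e0 _; apply: dist_to_ge => // c Cc.
by rewrite leNgt; apply/negP => xce; apply: (eC c) Cc; rewrite -ball_normE.
Qed.

(* The functionals supporting the distance to [C] at the points of a countable
   dense set. *)
Lemma separating_positive_functionals C : separable_space X -> is_cone C ->
  exists psi : nat -> {linear X -> R^o},
  [/\ forall k x, `|psi k x| <= `|x|,
      forall k x, C x -> 0 <= psi k x &
      forall x, (forall k, psi k x = 0) -> x = 0].
Proof.
move=> [D cD dD] cC; have C0 := cone0 cC; have sC := dist_to_sublinear cC.
have Cn0 : C !=set0 by exists 0.
have [g gD] : exists g : nat -> X, forall x, D x -> exists n, g n = x.
  move/pfcard_geP : cD => [->|[g]]; first by exists (fun=> 0).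
  exists g => x Dx; have [n _ gn] := @surj _ _ _ _ g x Dx; by exists n.
pose f k := projT1 (cid (hahn_banach (g k) sC)).
have fp k x : f k x <= dist_to C x by rewrite /f; case: cid => h [].
have fg k : f k (g k) = dist_to C (g k) by rewrite /f; case: cid => h [].
have dn x : dist_to C x <= `|x|.
  by have := dist_to_le x C0; rewrite subr0.
have fn k x : `|f k x| <= `|x|.
  rewrite ler_norml lerNl -raddfN (le_trans (fp _ _) (dn _)) andbT.
  by apply: le_trans (fp _ _) _; rewrite -[leRHS]normrN dn.
(* If [x] is outside [C], some [g k] is closer to [x] than half the distance from [x] to [C]. Since
   [f k x = 0], the distance from [g k] to [C], which is [f k (g k)], is also below that half,
   against the triangle inequality. *)
have sep x : (forall k, f k x = 0) -> C x.
  move=> fx; apply: contrapT => nCx.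
  have dx := dist_to_gt0 (let: And4 c _ _ _ := cC in c) Cn0 nCx.
  have [y [xy Dy]] : (ball x (dist_to C x / 2) `&` D) !=set0.
    apply: dD; last exact: ball_open.
    by exists x; apply: ballxx; rewrite divr_gt0.
  have [k gk] := gD _ Dy; move: xy; rewrite -gk -ball_normE /= => xy.
  have := fn k (g k - x); rewrite raddfB/= fx subr0 distrC => h.
  have := le_trans (ler_norm _) h; rewrite fg => h1.
  have := sC.1 (x - g k) (g k); rewrite subrK.
  have := dn (x - g k); lra.
(* Each [f k] lies below the distance, which vanishes on [C]; hence the change of sign. *)
exists (fun k => \- f k)%R; split=> [k x|k x Cx|x fx] /=.
- by rewrite normrN.
- rewrite oppr_ge0 (le_trans (fp _ _))//.
  by have := dist_to_le x Cx; rewrite subrr normr0.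
- have fx0 k : f k x = 0 by have /= /eqP := fx k; rewrite oppr_eq0 => /eqP.
  apply: (cone_anti cC); apply: sep => // k.
  by rewrite raddfN/= fx0 oppr0.
Qed.

End Cone.

(** * Bounds by the operator norm *)

Section Opnorm.
Context {R : realType} {X : normedModType R}.

Lemma opnorm_ge (L : X -> X) w : `|w| <= 1 -> (`|L w|%:E <= opnorm L)%E.
Proof. by move=> w1; apply: ereal_sup_ubound; exists w. Qed.

Lemma opnorm_le (L : X -> X) (b : \bar R) :
  (forall w, `|w| <= 1 -> (`|L w|%:E <= b)%E) -> (opnorm L <= b)%E.
Proof. by move=> Lb; apply: ge_ereal_sup => _ [w w1 <-]; exact: Lb. Qed.

Lemma opnorm_ge0 (L : X -> X) : (0 <= opnorm L)%E.
Proof.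
apply: le_trans (@opnorm_ge L 0 _); last by rewrite normr0.
by rewrite lee_fin.
Qed.

(** Rescaling to the unit ball. It is applied with [S] zero for the operator norm and with [S] a
    seminorm of [L w] for the Ehrling inequality. *)
Lemma scalable_bound (L : {linear X -> X}) (S : X -> R) (c : R) :
    (forall (k : R) w, S (k *: w) = `|k| * S w) ->
    (forall w, `|w| <= 1 -> `|L w| <= c + S w) ->
  forall w, `|L w| <= c * `|w| + S w.
Proof.
move=> SZ LS w; have [->|w0] := eqVneq w 0.
  by have := SZ 0 0; rewrite scale0r normr0 mul0r => ->; rewrite raddf0 normr0 mulr0 addr0.
have nw0 : 0 < `|w| by rewrite normr_gt0.
have := LS (`|w|^-1 *: w); rewrite linearZ SZ !normrZ normfV normr_id.
rewrite mulVf ?gt_eqF// => /(_ (lexx _)).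
by rewrite -(ler_pM2l nw0) mulrDr !mulVKf ?gt_eqF// mulrC.
Qed.

Lemma opnorm_bound (L : {linear X -> X}) (c : R) :
  (opnorm L <= c%:E)%E -> forall w, `|L w| <= c * `|w|.
Proof.
move=> Lc w; rewrite -[leRHS]addr0; apply: (@scalable_bound L (fun=> 0)).
  by move=> k v; rewrite mulr0.
by move=> v v1; rewrite addr0 -lee_fin; exact: le_trans (opnorm_ge _ v1) Lc.
Qed.

Lemma opnorm_near (D : X -> {linear X -> X}) z (e : R) : 0 < e ->
  opnorm (D y \- D z) @[y --> z] --> 0%E ->
  \forall y \near z, (opnorm (D y \- D z)%R <= e%:E)%E.
Proof.
move=> e0 Dc; have : \forall t \near (0%E : \bar R), (t < e%:E)%E.
  apply: open_nbhs_nbhs; split; first exact: open_ereal_lt_ereal.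
  by rewrite /= lte_fin.
move=> h; have {}h : \forall y \near z, (opnorm (D y \- D z)%R < e%:E)%E := Dc _ h.
by apply: filterS h => y /ltW.
Qed.

End Opnorm.

(** * Ehrling inequalities for compact operators *)

Section Ehrling.
Context {R : realType} {X : normedModType R}.
Context (psi : nat -> {linear X -> R^o}).
Context (psi_le : forall k x, `|psi k x| <= `|x|).
Context (psi_sep : forall x, (forall k, psi k x = 0) -> x = 0).

(** [N] is both the number of functionals and their weight, so that a single parameter tending to
    infinity controls both. *)
Definition seminorm (N : nat) (x : X) : R := N%:R * \sum_(k < N) `|psi k x|.

Lemma seminormZ N (k : R) x : seminorm N (k *: x) = `|k| * seminorm N x.
Proof.
rewrite /seminorm mulrCA; congr (_ * _); rewrite mulr_sumr.
by apply: eq_bigr => i _; rewrite linearZ/= normrM.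
Qed.

Lemma seminorm_mono M N x : (M <= N)%N -> seminorm M x <= seminorm N x.
Proof.
move=> MN; apply: ler_pM; rewrite ?sumr_ge0 ?ler_nat//.
rewrite -!(big_mkord xpredT (fun k => `|psi k x|)) (big_cat_nat (leq0n M) MN)//=.
by rewrite lerDl sumr_ge0.
Qed.

(** The constant comes from [N] functionals of norm at most 1, each with weight [N]. *)
Lemma seminorm_lip N x y : seminorm N x <= seminorm N y + N%:R ^+ 2 * `|x - y|.
Proof.
rewrite /seminorm expr2 -mulrA -mulrDr ler_wpM2l//.
rewrite -[N in X in _ + X]card_ord mulr_natl -sumr_const -big_split/=.
apply: ler_sum => k _; have := ler_normD (psi k (x - y)) (psi k y).
rewrite -linearD subrK; have := psi_le k (x - y); lra.
Qed.

(** The image of the unit ball has compact closure. Near 0 the constant [4^-1] alone bounds the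
    norm; near any other point some [psi k] stays away from 0 and a large weight suffices.
    Compactness makes [N] uniform. *)
Lemma ehrling (L : {linear X -> X}) : compact_operator L ->
  exists N, forall w, `|L w| <= 4^-1 * `|w| + seminorm N (L w).
Proof.
rewrite /compact_operator precompactE => /compact_near_coveringP cL.
have : \forall N \near \oo, closure [set L v | v in [set v | `|v| <= 1]] `<=`
    [set z | `|z| <= 4^-1 + seminorm N z].
  apply: cL => z _.
  have [->|z0] := eqVneq z 0.
    exists ([set z' | `|z'| <= 4^-1], setT) => /=.
      split; last exact: filterT.
      have := @nbhsx_ballx _ X 0 (4^-1) ltac:(by rewrite invr_gt0).
      by apply: filterS => y; rewrite -ball_normE/= sub0r normrN => /ltW.
    move=> [z' N] [/= z'4 _]; rewrite (le_trans z'4)// lerDl.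
    by rewrite mulr_ge0// sumr_ge0.
  have [k kz] : exists k, psi k z != 0.
    apply: contrapT => /forallNP psi0; move/eqP: z0; apply; apply: psi_sep => k.
    by apply/eqP/negPn/negP/psi0.
  have kz0 : 0 < `|psi k z| by rewrite normr_gt0.
  (* On the ball of radius [c] around [z], the absolute value of [psi k] is at least [c] and the
     norm at most [|z| + c]; this explains the threshold [(|z| + c) / c] for [N]. *)
  pose c := `|psi k z| / 2; have c0 : 0 < c by rewrite divr_gt0.
  exists (ball z c, [set N | (k < N)%N /\ (`|z| + c) / c <= N%:R]) => /=.
    split; first exact: nbhsx_ballx.
    apply: filterI; first by exists k.+1.
    exact: nbhs_infty_ger.
  move=> [z' N] [/=]; rewrite -ball_normE/= => zz' [kN cN].
  have kz' : c <= `|psi k z'|.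
    have := psi_le k (z - z'); rewrite raddfB/= => /le_lt_trans/(_ zz').
    have := ler_normD (psi k z - psi k z') (psi k z'); rewrite subrK.
    rewrite /c; lra.
  apply: (@le_trans _ _ (seminorm N z')); last by rewrite lerDr invr_ge0.
  apply: (@le_trans _ _ (N%:R * c)).
    apply: (@le_trans _ _ (`|z| + c)); last by rewrite -ler_pdivrMr.
    have := ler_normD (z' - z) z; rewrite subrK distrC; lra.
  apply: ler_wpM2l => //; apply: le_trans kz' _.
  by rewrite (bigD1 (Ordinal kN))//= lerDl sumr_ge0.
move=> /filter_ex[N LN]; exists N; apply: scalable_bound => [k w|w w1].
  by rewrite linearZ seminormZ.
by apply: LN; apply: subset_closure; exists w.
Qed.

(** The inequality for [D z] persists for nearby operators at the price of raising [4^-1] to [2^-1];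
    compactness of [K] then yields one [N]. *)
Lemma uniform_ehrling (K : set X) (D : X -> {linear X -> X}) : compact K ->
  (forall z, compact_operator (D z)) ->
  (forall z, opnorm (D y \- D z) @[y --> z] --> 0%E) ->
  exists N, forall z w, K z -> `|D z w| <= 2^-1 * `|w| + seminorm N (D z w).
Proof.
move=> /compact_near_coveringP cK cD Dc.
have : \forall N \near \oo, K `<=`
    [set z | forall w, `|D z w| <= 2^-1 * `|w| + seminorm N (D z w)].
  apply: cK => z _; have [M DM] := ehrling (cD z).
  (* Replacing [D z w] by [D y w] costs at most [e * |w|] in the norm and [M ^ 2 * e * |w|] in the
     seminorm, together [4^-1 * |w|]. *)
  pose e : R := 4^-1 / (1 + M%:R ^+ 2).
  have M0 : 0 < 1 + M%:R ^+ 2 :> R by rewrite ltr_pwDl// exprn_ge0.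
  have e0 : 0 < e by rewrite divr_gt0.
  exists ([set y | (opnorm (D y \- D z)%R <= e%:E)%E], [set N | (M <= N)%N]) => /=.
    by split; [exact: opnorm_near|exists M].
  move=> [y N] [/= Dyz MN] w.
  have Dw : `|D y w - D z w| <= e * `|w| by exact: (opnorm_bound Dyz).
  apply: (@le_trans _ _ (2^-1 * `|w| + seminorm M (D y w))); last first.
    by rewrite lerD2l seminorm_mono.
  have h1 := seminorm_lip M (D z w) (D y w).
  have h2 : (1 + M%:R ^+ 2) * `|D y w - D z w| <= 4^-1 * `|w|.
    apply: (@le_trans _ _ ((1 + M%:R ^+ 2) * (e * `|w|))).
      by apply: ler_wpM2l => //; exact: ltW.
    by rewrite mulrA /e (mulrC _ (_ / _)) divfK ?gt_eqF.
  have := ler_normD (D y w - D z w) (D z w); rewrite subrK.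
  have := DM w; rewrite (distrC (D z w)) in h1; lra.
by move=> /filter_ex[N KN]; exists N => z w /KN.
Qed.

End Ehrling.

(** * Positive Lyapunov exponents and Borel measurability of the chaotic set *)

Section Exponent.
Context {R : realType} {X : normedModType R} (Phi : R -> X -> X).

Lemma lne_div_ge (x : \bar R) (c t : R) : 0 < t -> (0 <= x)%E ->
  (c%:E <= lne x / t%:E)%E = ((expR (c * t))%:E <= x)%E.
Proof.
move=> t0 x0; rewrite inver gt_eqF// lee_pdivlMr//.
rewrite -[(c%:E * _)%E]/((c * t)%:E) -[LHS]lee_expeR lneK//.
by rewrite in_itv/= x0 leey.
Qed.

(** A positive lower limit is a positive lower bound on some half-line. One number [m] serves for
    both the rate and the half-line, since increasing it weakens both requirements. *)
Lemma chaotic_setE : chaotic_set Phi =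
  \bigcup_m \bigcap_(t in [set t : R | m%:R < t])
    [set x | ((expR (m.+1%:R^-1 * t))%:E <= opnorm ('d (Phi t) x))%E].
Proof.
apply/seteqP; split => [x|x [m _ xP]]; rewrite /chaotic_set /lambda_max/= limf_einfE.
  move=> /ereal_sup_gt[_ [V [M0 [_ MV]] <-]] inf0.
  have [m mV] : exists m, ((m.+1%:R^-1 : R)%:E <=
      ereal_inf ((fun t => (lne (opnorm ('d (Phi t) x)) / t%:E)%E) @` V))%E.
    move: inf0; case: ereal_inf => [r| |]; rewrite ?lte_fin// => r0.
      exists (Num.truncn r^-1); rewrite lee_fin invf_ple ?posrE//.
      by apply: ltW; rewrite truncnS_gt.
    by exists 0%N; rewrite leey.
  pose M := maxn m (Num.truncn `|M0|).+1; exists M => //= t /= Mt.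
  have M0t : M0 < t.
    apply: le_lt_trans (ler_norm _) _; apply: le_lt_trans Mt.
    apply: (@le_trans _ _ (Num.truncn `|M0|).+1%:R); first exact/ltW/truncnS_gt.
    by rewrite ler_nat leq_maxr.
  have t0 : 0 < t by apply: le_lt_trans Mt.
  rewrite /= -lne_div_ge// ?opnorm_ge0//.
  apply: (@le_trans _ _ (m.+1%:R^-1 : R)%:E).
    by rewrite lee_fin lef_pV2 ?posrE// ler_nat ltnS leq_maxl.
  apply: le_trans mV _; by apply: ereal_inf_lbound; exists t => //; exact: MV.
apply: (@lt_le_trans _ _ (m.+1%:R^-1 : R)%:E); first by rewrite lte_fin invr_gt0.
apply: le_trans (ereal_sup_ubound _); last first.
  exists [set t | m%:R < t] => //; exists m%:R; split=> //.
apply: le_ereal_inf_tmp => _ [t /= mt <-].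
rewrite lne_div_ge ?opnorm_ge0//; first exact: xP.
exact: le_lt_trans mt.
Qed.

Lemma opnorm_triangle (D : X -> {linear X -> X}) y z :
  (opnorm (D y) <= opnorm (D z) + opnorm (D y \- D z)%R)%E.
Proof.
apply: opnorm_le => w w1.
apply: (@le_trans _ _ (`|D z w|%:E + `|D y w - D z w|%:E)%E).
  rewrite -EFinD lee_fin; have := ler_normD (D z w) (D y w - D z w).
  by rewrite addrC subrK.
by apply: leeD; apply: (@opnorm_ge _ _ _ w w1).
Qed.

Lemma closed_opnorm_ge (D : X -> {linear X -> X}) (a : R) :
  (forall z, opnorm (D y \- D z) @[y --> z] --> 0%E) ->
  closed [set y | (a%:E <= opnorm (D y))%E].
Proof.
move=> Dc; rewrite -[X in closed X]setCK; apply: open_closedC.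
rewrite openE => z /= /negP; rewrite -ltNge => za.
have zfin : opnorm (D z) \is a fin_num.
  by rewrite ge0_fin_numE ?opnorm_ge0//; exact: lt_trans za (ltry _).
rewrite -(fineK zfin) lte_fin in za.
have e0 : 0 < (a - fine (opnorm (D z))) / 2 by rewrite divr_gt0 ?subr_gt0.
rewrite /interior; apply: filterS (opnorm_near e0 (Dc z)) => y /= yz.
apply/negP; rewrite -ltNge; apply: le_lt_trans (opnorm_triangle D y z) _.
apply: (@le_lt_trans _ _ (opnorm (D z) + ((a - fine (opnorm (D z))) / 2)%:E)%E).
  by rewrite leeD2l.
rewrite -(fineK zfin) -EFinD lte_fin/=; lra.
Qed.

(** The intersection over uncountably many times is harmless: each of its members is closed, by
    continuity of the derivative in operator norm. *)
Lemma chaotic_set_borel : C1_smooth Phi -> borel (chaotic_set Phi).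
Proof.
move=> C1; rewrite chaotic_setE.
apply: (@bigcupT_measurable _ (g_sigma_algebraType (@open X))) => m.
rewrite -[X in measurable X]setCK; apply: measurableC.
apply: sub_sigma_algebra; apply: closed_openC.
apply: closed_bigI => t /= mt.
have t0 : 0 < t by exact: le_lt_trans mt.
exact: (closed_opnorm_ge (C1 t t0).2).
Qed.

End Exponent.

(** * Derivatives along lines and Markov's inequality *)

Section Line.
Context {R : realType} {X : normedModType R}.

Lemma is_derive_line {W : normedModType R} (f : X -> W) x u (s : R) :
  differentiable f (x + s *: u) ->
  is_derive s (1 : R) (fun s : R => f (x + s *: u)) ('d f (x + s *: u) u).
Proof.
move=> df; have qE : (fun h : R => h^-1 *: (((fun s : R => f (x + s *: u)) \o
      shift s) (h *: (1 : R)) - f (x + s *: u))) =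
    (fun h => h^-1 *: ((f \o shift (x + s *: u)) (h *: u) - f (x + s *: u))).
  apply/funext => h /=; congr (_ *: (f _ - _)).
  by rewrite [h *: 1]mulr1 scalerDl addrCA.
split; first by rewrite /derivable qE; exact: diff_derivable.
by rewrite /derive qE -deriveE.
Qed.

(** The fundamental theorem of calculus gives the integral of [g] over the unit interval, and
    Markov's inequality concludes. *)
Lemma derivative_markov (h g : R -> R) (a : R) : 0 < a ->
  continuous g -> (forall s, 0 <= g s) -> (forall s, is_derive s (1 : R) h (g s)) ->
  (@lebesgue_measure R (`[0%R, 1%R] `&` [set s | (a < g s)%R]) <= ((h 1 - h 0) / a)%:E)%E.
Proof.
move=> a0 cg g0 dh.
have int : (\int[@lebesgue_measure R]_(s in `[0%R, 1%R]) (g s)%:E = (h 1 - h 0)%:E)%E.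
  rewrite (@continuous_FTC2 _ g h)//.
  - exact: continuous_subspaceT.
  - have ch s : {for s, continuous h}.
      by apply: differentiable_continuous; apply/derivable1_diffP; exact: ex_derive.
    split => [s _||]; first exact: ex_derive.
      by apply: cvg_at_right_filter; exact: ch.
    by apply: cvg_at_left_filter; exact: ch.
  - by move=> s _; rewrite derive1E; apply: derive_val.
have mg : measurable_fun (`[0, 1] : set R) (EFin \o g).
  apply/measurable_EFinP/measurable_funTS; exact: continuous_measurable_fun.
have := @le_integral_comp_abse _ _ _ (@lebesgue_measure R) (`[0, 1] : set R)
  (measurable_itv _) (EFin \o g) a id (@measurable_id _ _ _) _ _ mg a0.
move=> /(_ (fun _ => id) (fun _ _ _ _ => id)) /=.
under eq_integral => s _ do rewrite ger0_norm//.
rewrite int => am; rewrite EFinM lee_pdivlMr// muleC; apply: le_trans am.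
rewrite lee_pmul2l ?lte_fin//; apply: le_measure; rewrite ?inE.
- apply: measurableI => //; apply: open_measurable.
  rewrite (_ : [set s | _] = g @^-1` [set t | a < t])//.
  by apply: open_comp => [s _|]; [exact: cg|exact: open_gt].
- apply: measurableI => //; apply: closed_measurable.
  rewrite (_ : [set x | _] = g @^-1` [set t | a <= t]); last first.
    by apply/seteqP; split => s /=; rewrite lee_fin ger0_norm.
  by apply: preimage_closed => [s _|]; [exact: cg|exact: closed_ge].
- by move=> s [s01 /= ags]; split=> //=; rewrite lee_fin ger0_norm// ltW.
Qed.

End Line.

(** * Lebesgue measure on a segment as a witness of shyness *)

Section Segment.
Context {R : realType} {X : normedModType R}.

Lemma continuous_borel (f : R -> X) (W : set X) :
  continuous f -> borel W -> measurable (f @^-1` W : set R).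
Proof.
move=> cf bW.
have mf : measurable_fun setT (f : R -> g_sigma_algebraType (@open X)).
  apply: (@measurability _ _ (measurableTypeR R) (g_sigma_algebraType (@open X))
    setT f (@open X)) => // _ [A oA <-].
  by rewrite setTI; apply: open_measurable; apply: open_comp => // s _; exact: cf.
by rewrite -[X in measurable X]setTI; exact: mf.
Qed.

Lemma line_continuous (x u : X) : continuous (fun s : R => x + s *: u).
Proof. by move=> s; apply: cvgD; [exact: cvg_cst|apply: cvgZr_tmp; exact: cvg_id]. Qed.

(** The push-forward of Lebesgue measure on the unit interval under [s *: u]; the term [0 +]
    presents it as a line [x + s *: u]. *)
Definition segment_measure (u : X) (A : set (g_sigma_algebraType (@open X))) : \bar R :=
  @lebesgue_measure R (`[0%R, 1%R] `&` [set s | A (0 + s *: u)]).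

Section instances.
Variable u : X.
Local Notation mu := (segment_measure u).

Let mpre (A : set X) : borel A -> measurable (`[0%R, 1%R] `&` [set s | A (0 + s *: u)] : set R).
Proof.
move=> bA; apply: measurableI => //.
exact: (@continuous_borel (fun s => 0 + s *: u) A (@line_continuous 0 u) bA).
Qed.

Let mu0 : mu set0 = 0%E.
Proof. by rewrite /segment_measure (_ : _ `&` _ = set0) ?measure0// setI0. Qed.

Let mu_ge0 A : (0 <= mu A)%E.
Proof. exact: measure_ge0. Qed.

Let mu_semi_sigma_additive : semi_sigma_additive mu.
Proof.
move=> F mF tF mUF; rewrite /segment_measure.
have -> : [set s | (\bigcup_n F n) (0 + s *: u)] = \bigcup_n [set s | F n (0 + s *: u)].
  by apply/seteqP; split => s /= [n _ Fn]; exists n.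
rewrite setI_bigcupr; apply: measure_semi_sigma_additive.
- by move=> n; exact: (mpre (mF n)).
- apply/trivIsetP => /= i j _ _ ij; rewrite setIACA setIid -subset0 => s [_ [Fi Fj]].
  move/trivIsetP : tF => /(_ _ _ I I ij) FF.
  by have : (F i `&` F j) (0 + s *: u) by []; rewrite FF.
- by rewrite -setI_bigcupr; apply: (mpre mUF).
Qed.

HB.instance Definition _ := isMeasure.Build _ _ _ mu mu0 mu_ge0 mu_semi_sigma_additive.

Let mu_fin : fin_num_fun mu.
Proof.
move=> A mA; rewrite ge0_fin_numE// /segment_measure.
apply: (@le_lt_trans _ _ (@lebesgue_measure R `[0%R, 1%R])).
  by apply: le_measure; rewrite ?inE; [exact: (mpre mA)|exact: measurable_itv|exact: subIsetl].
by rewrite lebesgue_measure_itv/= lte_fin ltr01 sube0 ltry.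
Qed.

HB.instance Definition _ := Measure_isFinite.Build _ _ _ mu mu_fin.

End instances.

Lemma shy_segment (u : X) (W : set X) : borel W ->
  (forall x, @lebesgue_measure R (`[0%R, 1%R] `&` [set s | W (x + s *: u)]) = 0%E) ->
  shy W.
Proof.
move=> bW W0; split=> //; exists (segment_measure u); split.
- rewrite /= /segment_measure (_ : _ `&` _ = `[0%R, 1%R]%classic).
    by rewrite lebesgue_measure_itv/= lte_fin ltr01 sube0.
  by apply/seteqP; split => s // [].
- exists ((fun s => 0 + s *: u) @` `[0%R, 1%R]%classic).
    apply: continuous_compact; last exact: segment_compact.
    by apply: continuous_subspaceT; exact: line_continuous.
  rewrite /= /segment_measure (_ : _ `&` _ = set0) ?measure0//.
  by rewrite -subset0 => s /= [s01]; apply; exists s.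
(* Translating [W] by [x] amounts to moving the base point of the line to [- x]. *)
- move=> x; rewrite /= /segment_measure -(W0 (- x)); congr (lebesgue_measure (_ `&` _)).
  apply/seteqP; split => s /=; rewrite add0r.
    by move=> [w Ww <-]; rewrite addrC addrK.
  by move=> Ws; exists (- x + s *: u) => //; rewrite addrC addrA subrr add0r.
Qed.

End Segment.

(** * The Borel-Cantelli lemma for outer measures, and Lebesgue outer measure *)

Section Outer.
Context {R : realType}.

(** Borel-Cantelli from countable subadditivity alone, hence for arbitrary sets: the upper limit
    lies in every tail union, and the tail sums tend to 0. *)
Lemma outer_lim_sup_set0 {T : Type} (mu : {outer_measure set T -> \bar R})
    (E : (set T)^nat) :
  (\sum_(n <oo) mu (E n) < +oo)%E -> mu (lim_sup_set E) = 0%E.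
Proof.
move=> Eoo; apply/eqP; rewrite eq_le outer_measure_ge0 andbT.
have tail0 : (\sum_(i <= n <oo) mu (E n))%E @[i --> \oo] --> 0%E.
  by apply: nneseries_tail_cvg => // n _; exact: outer_measure_ge0.
rewrite -(cvg_lim _ tail0)//; apply: lime_ge; first by apply/cvg_ex; exists 0%E.
apply: nearW => N; apply: le_trans (outer_measure_sigma_subadditive_tail mu N E).
apply: le_outer_measure => x /(_ N I)[n /= Nn En]; exists n => //=.
by apply/negP; rewrite -leqNgt.
Qed.

Context {d : nat}.
Local Notation rV := 'rV[R]_d.

Lemma box_volume_ge0 (a b : rV) : 0 <= box_volume a b.
Proof. by apply: prodr_ge0 => i _; rewrite le_max lexx. Qed.

(** The cover is re-indexed by [nat] through [pickle]; the default 0 in [ext] occurs only at indices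
    outside the image of [D]. *)
Lemma lebesgue_outer_cover (I : countType) (D : set I) (a b : I -> rV) (A : set rV) :
  A `<=` \bigcup_(i in D) box (a i) (b i) ->
  (lebesgue_outer A <= \esum_(i in D) (box_volume (a i) (b i))%:E)%E.
Proof.
move=> AD; apply: ereal_inf_lbound.
pose ext (c : I -> rV) n := if unpickle n is Some i then c i else 0.
have extK c i : ext c (pickle i) = c i by rewrite /ext pickleK.
exists (pickle @` D), (ext a), (ext b); split.
  by move=> x /AD[i Di xi]; exists (pickle i); [exists i|rewrite !extK].
rewrite (reindex_esum D _ pickle).
  by apply: eq_esum => i _; rewrite !extK.
split=> [i Di|i j _ _ ij|_ [i Di <-]]; [by exists i| |by exists i].
exact: (pcan_inj (@pickleK I)).
Qed.

Lemma lebesgue_outer_approx (A : set rV) (e : R) : 0 < e ->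
  (lebesgue_outer A < +oo)%E ->
  exists (D : set nat) (a b : nat -> rV),
    A `<=` \bigcup_(k in D) box (a k) (b k) /\
    (\esum_(k in D) (box_volume (a k) (b k))%:E <= lebesgue_outer A + e%:E)%E.
Proof.
move=> e0 Aoo; have Afin : lebesgue_outer A \is a fin_num.
  rewrite ge0_fin_numE//; apply: le_ereal_inf_tmp => _ [D [a [b [_ ->]]]].
  by apply: esum_ge0 => k _; rewrite lee_fin box_volume_ge0.
have [_ [D [a [b [AD ->]]]] /ltW le] := lb_ereal_inf_adherent e0 Afin.
by exists D, a, b.
Qed.

Let lebesgue_outer0 : lebesgue_outer (set0 : set rV) = 0%E.
Proof.
apply/eqP; rewrite eq_le; apply/andP; split.
  apply: le_trans (@lebesgue_outer_cover nat set0 (fun=> 0) (fun=> 0) _ _) _ => //.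
  by rewrite esum_set0.
apply: le_ereal_inf_tmp => _ [D [a [b [_ ->]]]].
by apply: esum_ge0 => k _; rewrite lee_fin box_volume_ge0.
Qed.

Let lebesgue_outer_ge0 (A : set rV) : (0 <= lebesgue_outer A)%E.
Proof.
apply: le_ereal_inf_tmp => _ [D [a [b [_ ->]]]].
by apply: esum_ge0 => k _; rewrite lee_fin box_volume_ge0.
Qed.

Let le_lebesgue_outer : {homo (@lebesgue_outer R d) : A B / A `<=` B >-> (A <= B)%E}.
Proof.
move=> A B AB; apply: ereal_inf_le_tmp => _ [D [a [b [BD ->]]]].
by exists D, a, b; split=> //; exact: subset_trans BD.
Qed.

(** Nearly optimal covers of the sets [A n], with errors [e / 2 ^ n.+1], merge into one cover
    indexed by [nat * nat]. *)
Let lebesgue_outer_subadditive : sigma_subadditive (@lebesgue_outer R d).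
Proof.
move=> A; have [[n An]|Afin] := pselect (exists n, lebesgue_outer (A n) = +oo%E).
  rewrite (eseries_pinfty _ _ An) ?leey// => k _.
  by rewrite gt_eqF// (lt_le_trans _ (lebesgue_outer_ge0 _)).
apply/lee_addgt0Pr => e e0.
have cov n : exists p : set nat * (nat -> rV) * (nat -> rV),
    A n `<=` \bigcup_(k in p.1.1) box (p.1.2 k) (p.2 k) /\
    (\esum_(k in p.1.1) (box_volume (p.1.2 k) (p.2 k))%:E <=
      lebesgue_outer (A n) + (e / (2 ^ n.+1)%:R)%:E)%E.
  have e'0 : 0 < e / (2 ^ n.+1)%:R by rewrite divr_gt0// ltr0n expn_gt0.
  have Anoo : (lebesgue_outer (A n) < +oo)%E.
    by rewrite ltey; apply/eqP => An; apply: Afin; exists n.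
  by have [D [a [b ab]]] := lebesgue_outer_approx e'0 Anoo; exists (D, a, b).
pose p n := sval (cid (cov n)).
have pA n : A n `<=` \bigcup_(k in (p n).1.1) box ((p n).1.2 k) ((p n).2 k).
  by rewrite /p; case: cid => q [].
have pe n : (\esum_(k in (p n).1.1) (box_volume ((p n).1.2 k) ((p n).2 k))%:E <=
    lebesgue_outer (A n) + (e / (2 ^ n.+1)%:R)%:E)%E.
  by rewrite /p; case: cid => q [].
apply: (@le_trans _ _ (\sum_(n <oo) (lebesgue_outer (A n) + (e / (2 ^ n.+1)%:R)%:E))%E);
  last by apply: epsilon_trick => //; exact: ltW.
apply: (@le_trans _ _ (\sum_(n <oo)
    (\esum_(k in (p n).1.1) (box_volume ((p n).1.2 k) ((p n).2 k))%:E))%E); last first.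
  apply: lee_nneseries => [n _ _|n *]; last exact: pe.
  by apply: esum_ge0 => k _; rewrite lee_fin box_volume_ge0.
rewrite nneseries_esumT; last first.
  by move=> n; apply: esum_ge0 => k _; rewrite lee_fin box_volume_ge0.
rewrite esum_esum; last by move=> n k _ _; rewrite lee_fin box_volume_ge0.
apply: (@lebesgue_outer_cover _ _ (fun k : nat * nat => (p k.1).1.2 k.2)
  (fun k => (p k.1).2 k.2)) => x [n _ /pA[k pk xk]].
by exists (n, k).
Qed.

HB.instance Definition _ := isOuterMeasure.Build R rV (@lebesgue_outer R d)
  lebesgue_outer0 lebesgue_outer_ge0 le_lebesgue_outer lebesgue_outer_subadditive.

Lemma lebesgue_outer_null (A : set rV) : lebesgue_outer A = 0%E -> lebesgue_null A.
Proof.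
move=> A0; split=> // B; apply/eqP; rewrite eq_le; apply/andP; split.
  by rewrite -[in leLHS](setUIDK B A); exact: outer_measureU2.
rewrite (_ : lebesgue_outer (B `&` A) = 0%E) ?add0e.
  by apply: le_outer_measure; exact: subIsetl.
apply/eqP; rewrite eq_le outer_measure_ge0 andbT -A0.
by apply: le_outer_measure; exact: subIsetr.
Qed.

End Outer.

(** * Sup norm, uniform continuity on balls, and grid cells *)

Section GridBasics.
Context {R : realType}.

Lemma rV_norm_le d (v : 'rV[R]_d) (r : R) : 0 <= r ->
  (forall i, `|v ord0 i| <= r) -> `|v| <= r.
Proof.
move=> r0 vr; rewrite -[leLHS]/(mx_norm v).
have [->//|/mx_norm_neq0[[i j] ->]] := eqVneq (mx_norm v) 0.
by rewrite /= (ord1 i).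
Qed.

Lemma rV_norm_ge d (v : 'rV[R]_d) i : `|v ord0 i| <= `|v|.
Proof.
have [v0|v0] := eqVneq v 0; first by rewrite v0 mxE !normr0.
rewrite [leRHS]mx_normrE.
by apply: (le_bigmax _ (fun i => `|v i.1 i.2|) (ord0, i)).
Qed.

Lemma rV_closed_ball_compact d (B : R) : compact [set a : 'rV[R]_d | `|a| <= B].
Proof.
apply: bounded_closed_compact.
  exists B; split=> [|M BM a /= aB]; first exact: num_real.
  exact: le_trans aB (ltW BM).
rewrite (_ : [set a | _] = (fun a : 'rV[R]_d => `|a|) @^-1` [set t | t <= B])//.
by apply: preimage_closed => [a _|]; [exact: norm_continuous|exact: closed_le].
Qed.

Lemma compact_modulus d (g : 'rV[R]_d -> R) (B e : R) : continuous g -> 0 < e ->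
  \forall r \near 0^'+, forall a b, `|a| <= B -> `|a - b| <= r -> `|g a - g b| <= e.
Proof.
move=> cg e0.
have /compact_near_coveringP cB := @rV_closed_ball_compact d B.
have : \forall r \near 0^'+, [set a : 'rV[R]_d | `|a| <= B] `<=`
    [set a | forall b, `|a - b| <= r -> `|g a - g b| <= e].
  apply: cB => a _.
  have e20 : 0 < e / 2 by rewrite divr_gt0.
  have /nbhs_ballP[s /= s0 sP] : \forall b \near a, `|g a - g b| < e / 2.
    by have /cvgrPdist_lt := cg a; exact.
  have s20 : 0 < s / 2 by rewrite divr_gt0.
  exists (ball a (s / 2), [set r | r < s / 2]) => /=.
    by split; [exact: nbhsx_ballx|exact: nbhs_right_lt].
  move=> [a' r] [/=]; rewrite -ball_normE /= => aa' rs b a'b.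
  have h1 : `|g a - g a'| < e / 2.
    by apply: sP; rewrite -ball_normE/=; lra.
  have h2 : `|g a - g b| < e / 2.
    apply: sP; rewrite -ball_normE/=.
    have := ler_normD (a - a') (a' - b); rewrite addrA subrK; lra.
  have := ler_normD (g a' - g a) (g a - g b); rewrite addrA subrK (distrC (g a') (g a)); lra.
by apply: filterS => r rP a b aB; exact: rP.
Qed.

Lemma grid_index (N : nat) (B x : R) : (0 < N)%N -> 0 < B -> `|x| <= B ->
  exists j : 'I_N, 0 <= x - (- B + 2 * B / N%:R * j%:R) <= 2 * B / N%:R.
Proof.
move=> N0 B0; rewrite ler_norml => /andP[xB Bx].
have N0' : 0 < N%:R :> R by rewrite ltr0n.
pose e := 2 * B / N%:R; have e0 : 0 < e by rewrite divr_gt0 ?mulr_gt0.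
have eN : e * N%:R = 2 * B by rewrite /e divfK ?gt_eqF.
pose y := (x + B) / e; have yE : y * e = x + B by rewrite /y divfK ?gt_eqF.
have y0 : 0 <= y by rewrite divr_ge0 ?(ltW e0)//; lra.
have [yN|Ny] := ltP y N%:R.
  have /andP[jy yj] := truncn_itv y0.
  have jN : (Num.truncn y < N)%N by rewrite -(ltr_nat R); exact: le_lt_trans jy yN.
  exists (Ordinal jN); rewrite /= -/e.
  have := ler_wpM2r (ltW e0) jy; have := ler_wpM2r (ltW e0) (ltW yj).
  rewrite yE -natr1 => h1 h2; apply/andP; split; lra.
(* Here [x = B], where the integer part of [y] is [N], one too large; the last cell contains this
   endpoint. *)
have jN : (N.-1 < N)%N by rewrite prednK.
have NE : N.-1%:R + 1 = N%:R :> R by rewrite natr1 prednK.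
exists (Ordinal jN); rewrite /= -/e.
have := ler_wpM2r (ltW e0) Ny; rewrite yE => h1.
have h2 : e * N.-1%:R + e = 2 * B by rewrite -eN -NE mulrDr mulr1.
by apply/andP; split; lra.
Qed.

Lemma lebesgue_outer_fin_cover d (I : finType) (a b : I -> 'rV[R]_d) (A : set 'rV[R]_d) :
  A `<=` \bigcup_i box (a i) (b i) ->
  (lebesgue_outer A <= (\sum_i box_volume (a i) (b i))%:E)%E.
Proof.
move=> /lebesgue_outer_cover /le_trans; apply.
apply: ge_ereal_sup => _ [X [finX _] <-].
rewrite fsbig_finite// sumEFin lee_fin.
rewrite big_uniq ?finmap.fset_uniq// [leLHS]big_mkcond/=; apply: ler_sum => i _.
by case: ifP => // _; exact: box_volume_ge0.
Qed.

End GridBasics.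

(** * Outer measure of the set where a directional derivative is large *)

Section Grid.
Context {R : realType} (d : nat) (i0 : 'I_d.+1).
Local Notation rV := 'rV[R]_d.+1.

(* The coordinate [i0] is indexed apart from the others, so that sums of
   increments in that direction telescope. *)
Definition grid_corner (B : R) (N : nat) (f : {ffun 'I_d -> 'I_N}) (j : nat) : rV :=
  \row_i (- B + 2 * B / N%:R * (if unlift i0 i is Some k then (f k)%:R else j%:R)).

Lemma grid_cornerS B N (f : {ffun 'I_d -> 'I_N}) j :
  grid_corner B f j.+1 = grid_corner B f j + (2 * B / N%:R) *: delta_mx ord0 i0.
Proof.
apply/rowP => i; rewrite !mxE eqxx /=; case: unliftP => [k ->|->].
  by rewrite eq_sym (negbTE (neq_lift _ _)) mulr0 addr0.
by rewrite eqxx -[j.+1%:R]natr1 mulrDr addrA.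
Qed.

Lemma grid_corner_norm B N (f : {ffun 'I_d -> 'I_N}) (j : nat) : 0 < B ->
  (0 < N)%N -> (j <= N)%N -> `|grid_corner B f j| <= B.
Proof.
move=> B0 N0 jN; apply: rV_norm_le; first exact: ltW.
move=> i; rewrite mxE; set n := (X in _ + _ * X).
have /andP[n0 nN] : 0 <= n <= N%:R.
  by rewrite /n; case: unlift => [k|]; rewrite ler0n ler_nat// ltnW.
have N0' : 0 < N%:R :> R by rewrite ltr0n.
have e0 : 0 < 2 * B / N%:R by rewrite divr_gt0 ?mulr_gt0.
have eN : 2 * B / N%:R * N%:R = 2 * B by rewrite divfK ?gt_eqF.
have := ler_wpM2l (ltW e0) n0; have := ler_wpM2l (ltW e0) nN.
by rewrite eN mulr0 ler_norml => h1 h2; apply/andP; split; lra.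
Qed.

Lemma grid_cover B N (a : rV) : 0 < B -> (0 < N)%N -> `|a| <= B ->
  exists (f : {ffun 'I_d -> 'I_N}) (j : 'I_N),
    forall i, 0 <= a ord0 i - grid_corner B f j ord0 i <= 2 * B / N%:R.
Proof.
move=> B0 N0 aB.
have idx i := grid_index N0 B0 (le_trans (rV_norm_ge a i) aB).
exists [ffun k => sval (cid (idx (lift i0 k)))], (sval (cid (idx i0))) => i.
rewrite mxE; case: unliftP => [k ->|->]; first by rewrite ffunE; case: cid.
by case: cid.
Qed.

(** A discrete Markov inequality. Cut the cube into cells of side [e = 2 * B / N]. If [g] exceeds
    [t] somewhere in a cell, [H] grows by at least [t / 2 * e] along its edge in direction [i0]. The
    increments telescope to at most [2 * M] on each of the [N ^ d] rows, and [L] maps a cell into a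
    box of side [2 * c * e]. The product [e ^ d * N ^ d] is [(2 * B) ^ d]. *)
Lemma directional_measure_bound (L : rV -> rV) (c B M t : R) (H g : rV -> R) :
  0 < c -> (forall x y, `|L x - L y| <= c * `|x - y|) -> 0 < B -> 0 < t ->
  continuous g -> (forall a, 0 <= g a) -> (forall a, `|a| <= B -> `|H a| <= M) ->
  (forall a (s : R), is_derive s (1 : R) (fun s : R => H (a + s *: delta_mx ord0 i0))
    (g (a + s *: delta_mx ord0 i0))) ->
  (lebesgue_outer (L @` [set a | (`|a| <= B)%R /\ (t < g a)%R]) <=
    ((2 * B) ^+ d * (2 * c) ^+ d.+1 * (4 * M / t))%:E)%E.
Proof.
move=> c0 Lc B0 t0 cg g0 HM dH.
have [r [r0 gr]] : exists r : R, 0 < r /\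
    forall a b, `|a| <= B -> `|a - b| <= r -> `|g a - g b| <= t / 2.
  apply: (@filter_ex _ (0^'+ : set_system R)); apply: filterI.
    exact: nbhs_right_gt.
  by apply: compact_modulus => //; rewrite divr_gt0.
(* [N] is large enough for the side [e] of a cell to be at most [r]. *)
pose N := (Num.truncn (2 * B / r)).+1; pose e := 2 * B / N%:R.
have N0 : 0 < N%:R :> R by rewrite ltr0n.
have e0 : 0 < e by rewrite divr_gt0 ?mulr_gt0.
have er : e <= r.
  by rewrite /e ler_pdivrMr// [r * _]mulrC -ler_pdivrMr//; exact/ltW/truncnS_gt.
pose p (f : {ffun 'I_d -> 'I_N}) j := grid_corner B f j.
pose bad (q : {ffun 'I_d -> 'I_N} * 'I_N) : bool := `[< exists a, [/\ `|a| <= B,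
  t < g a & forall i, 0 <= a ord0 i - p q.1 q.2 ord0 i <= e] >].
pose D f j := H (p f j.+1) - H (p f j).
(* The mean value theorem turns the increment over an edge into a value of [g] on that edge. *)
have DE f j : exists s, [/\ 0 <= s, s <= e & D f j = g (p f j + s *: delta_mx ord0 i0) * e].
  have cH : {within `[0, e], continuous (fun s : R => H (p f j + s *: delta_mx ord0 i0))}.
    apply: continuous_subspaceT => s; apply: differentiable_continuous.
    by apply/derivable1_diffP; apply: ex_derive; exact: dH.
  have [s] := MVT_segment (ltW e0) (fun s _ => dH (p f j) s) cH.
  rewrite in_itv/= => /andP[s0 se]; rewrite scale0r addr0 subr0 => Ds.
  by exists s; split=> //; rewrite /D /p grid_cornerS.
have D0 f j : 0 <= D f j by have [s [_ _ ->]] := DE f j; rewrite mulr_ge0 ?g0 ?(ltW e0).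
have Dbad (q : {ffun 'I_d -> 'I_N} * 'I_N) : bad q -> t / 2 * e <= D q.1 q.2.
  move=> /asboolP[a [aB ta ap]]; have [s [s0 se ->]] := DE q.1 q.2.
  apply: ler_wpM2r; first exact: ltW.
  have : `|g a - g (p q.1 q.2 + s *: delta_mx ord0 i0)| <= t / 2.
    apply: gr => //; apply: le_trans er; apply: rV_norm_le; first exact: ltW.
    move=> i; have /andP[l u] := ap i.
    have -> : (a - (p q.1 q.2 + s *: delta_mx ord0 i0)) ord0 i =
        a ord0 i - (p q.1 q.2 ord0 i + s * (i == i0)%:R).
      by rewrite 3!mxE; congr (_ - (_ + _)); rewrite !mxE eqxx.
    have : 0 <= s * (i == i0)%:R <= e.
      by case: eqP => _; rewrite ?mulr1 ?mulr0 ?lexx ?(ltW e0)// s0.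
    by move=> /andP[h1 h2]; rewrite ler_norml; apply/andP; split; lra.
  by rewrite ler_norml => /andP[_]; lra.
(* A cell that is not bad receives the box reduced to the point 0, of volume 0 because the dimension
   is positive. *)
pose lo q : rV := if bad q then L (p q.1 q.2) - const_mx (c * e) else 0.
pose hi q : rV := if bad q then L (p q.1 q.2) + const_mx (c * e) else 0.
apply: le_trans (@lebesgue_outer_fin_cover R _ _ lo hi _ _) _.
  move=> _ [a [aB ta] <-].
  have [f [j apj]] := grid_cover B0 (ltn0Sn _ : (0 < N)%N) aB.
  have b : bad (f, j) by apply/asboolP; exists a.
  exists (f, j) => // i; rewrite /lo /hi b /= 4!mxE.
  have : `|L a - L (p f j)| <= c * e.
    apply: le_trans (Lc _ _) _; rewrite ler_pM2l//.
    apply: rV_norm_le; first exact: ltW.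
    move=> k; rewrite 2!mxE; have /andP[l u] := apj k.
    by rewrite ger0_norm.
  move=> /(le_trans (rV_norm_ge _ i)); rewrite 2!mxE ler_norml => /andP[h1 h2].
  by rewrite !mxE; apply/andP; split; lra.
rewrite lee_fin.
pose V := (2 * (c * e)) ^+ d.+1.
have V0 : 0 <= V by apply: exprn_ge0; rewrite mulr_ge0// mulr_ge0// ltW.
have K0 : 0 <= 2 / (t * e) by rewrite divr_ge0// mulr_ge0 ?(ltW t0) ?(ltW e0).
(* For a bad cell the factor multiplying [V] is at least 1, by [Dbad]. *)
have vol q : box_volume (lo q) (hi q) <= V * (2 / (t * e)) * D q.1 q.2.
  rewrite /lo /hi; case: ifPn => bq.
    have -> : box_volume (L (p q.1 q.2) - const_mx (c * e))
        (L (p q.1 q.2) + const_mx (c * e)) = V.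
      rewrite /box_volume (eq_bigr (fun=> 2 * (c * e))).
        by rewrite prodr_const card_ord.
      by move=> i _; have := mulr_gt0 c0 e0; rewrite !mxE => ?; rewrite max_r; lra.
    rewrite -mulrA ler_peMr//.
    have KE : 2 / (t * e) * (t / 2 * e) = 1 by field; rewrite !gt_eqF.
    rewrite -[leLHS]KE.
    by apply: ler_wpM2l => //; exact: Dbad.
  rewrite /box_volume (bigD1 ord0)//= !mxE subrr maxxx mul0r.
  by rewrite mulr_ge0 ?D0// mulr_ge0.
apply: le_trans (ler_sum _ (fun q _ => vol q)) _.
rewrite -mulr_sumr -(pair_bigA _ (fun f (j : 'I_N) => D f j))/=.
have tel f : \sum_(j < N) D f j <= 2 * M.
  rewrite -(big_mkord xpredT (D f)) telescope_sumr//.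
  have := HM _ (grid_corner_norm f B0 (ltn0Sn _) (leqnn N)).
  have := HM _ (grid_corner_norm f B0 (ltn0Sn _) (leq0n N)).
  by rewrite !ler_norml => /andP[h1 h2] /andP[h3 h4]; rewrite /p; lra.
apply: (@le_trans _ _ (V * (2 / (t * e)) * (N%:R ^+ d * (2 * M)))).
  apply: ler_wpM2l; first by rewrite mulr_ge0.
  apply: le_trans (ler_sum _ (fun f _ => tel f)) _.
  by rewrite sumr_const card_ffun !card_ord -natrX [leRHS]mulr_natl.
have BE : 2 * B = e * N%:R by rewrite /e divfK ?gt_eqF.
rewrite BE /V le_eqVlt; apply/orP; left; apply/eqP.
clear -e0 t0.
move: (N%:R : R) => n; clearbody e.
rewrite !exprMn !exprS; field.
by rewrite !gt_eqF.
Qed.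

End Grid.

(** * Linear coordinates, countable unions of null sets, and a geometric series *)

Section Auxiliary.
Context {R : realType} {X : normedModType R}.

(** The inverse is linear, and expansion in the standard basis bounds it whatever the norm of
    [X]. *)
Lemma inverse_lipschitz d (f : {linear X -> 'rV[R]_d}) (F : 'rV[R]_d -> X) :
  cancel f F -> cancel F f ->
  exists2 K : R, 0 < K & forall z z', `|F z - F z'| <= K * `|z - z'|.
Proof.
move=> fK Fk.
have FB z z' : F z - F z' = F (z - z').
  by apply: (can_inj fK); rewrite raddfB/= !Fk.
have FE z : F z = \sum_i z ord0 i *: F (delta_mx ord0 i).
  apply: (can_inj fK); rewrite Fk raddf_sum/= [LHS]row_sum_delta.
  by apply: eq_bigr => i _; rewrite linearZ/= Fk.
exists (1 + \sum_i `|F (delta_mx ord0 i)|); first by rewrite ltr_pwDl// sumr_ge0.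
move=> z z'; rewrite FB FE; apply: le_trans (ler_norm_sum _ _ _) _.
rewrite mulrDl mul1r mulr_suml; apply: (@le_trans _ _
  (\sum_i `|F (delta_mx ord0 i)| * `|z - z'|)); last by rewrite lerDr.
by apply: ler_sum => i _; rewrite normrZ mulrC ler_wpM2l// rV_norm_ge.
Qed.

Lemma lipschitz_map_continuous {V W : normedModType R} (h : V -> W) (K : R) :
  0 < K -> (forall x y, `|h x - h y| <= K * `|x - y|) -> continuous h.
Proof.
move=> K0 hK x; apply/cvgrPdist_lt => e e0.
have e1 : 0 < e / K by rewrite divr_gt0.
apply: filterS (nbhsx_ballx x _ e1) => y; rewrite -ball_normE/= => xy.
by apply: le_lt_trans (hK _ _) _; rewrite -ltr_pdivlMl// mulrC.
Qed.

Lemma countable_union_null {T : Type} (mu : {outer_measure set T -> \bar R})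
    (A : (set T)^nat) : (forall n, mu (A n) = 0%E) -> mu (\bigcup_n A n) = 0%E.
Proof.
move=> A0; apply/eqP; rewrite eq_le outer_measure_ge0 andbT.
by apply: le_trans (outer_measure_sigma_subadditive mu A) _; rewrite eseries0.
Qed.

Lemma exp_series_le (c d : R) n : 0 <= c -> 0 < d ->
  \sum_(0 <= i < n) c / expR (i%:R * d) <= c / (1 - expR (- d)).
Proof.
move=> c0 d0.
have := @geometric_le_lim R n c (expR (- d)) c0 (expR_gt0 _).
rewrite ger0_norm ?expR_ge0// -expR0 ltr_expR oppr_lt0 => /(_ d0).
rewrite expR0; congr (_ <= _); rewrite seriesEnat /=; apply: eq_bigr => i _.
by rewrite -expRM_natl mulrN expRN.
Qed.

End Auxiliary.

(** * Positivity of the derivative of a monotone semiflow *)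

Section ChaoticSetNull.
Context {R : realType} {X : normedModType R} (C : set X) (Phi : R -> X -> X).
Context (cC : is_cone C) (sfPhi : is_semiflow Phi) (C1 : C1_smooth Phi).
Context (mPhi : strongly_monotone C Phi).

Lemma semiflow_diff t s x : 0 < t -> 0 < s ->
  'd (Phi (t + s)) x = 'd (Phi t) (Phi s x) \o 'd (Phi s) x :> (X -> X).
Proof.
move=> t0 s0; have -> : Phi (t + s) = Phi t \o Phi s.
  by case: sfPhi => _ _ PhiD; apply/funext => y; rewrite PhiD// ltW.
by rewrite diff_comp//; apply: (C1 _).1.
Qed.

Lemma semiflow_mono t x y : 0 < t -> C (y - x) -> C (Phi t y - Phi t x).
Proof.
move=> t0 xy; have [->|yx0] := eqVneq y x; first by rewrite subrr; exact: cone0.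
apply: interior_subset; apply: mPhi => //; split=> //= /eqP.
by rewrite subr_eq0 (negbTE yx0).
Qed.

(** The difference quotients lie in the closed cone [C]; for [h < 0] both the increment and the
    factor [h^-1] change sign. *)
Lemma semiflow_diff_ge0 t x v : 0 < t -> C v -> C ('d (Phi t) x v).
Proof.
move=> t0 Cv; have dPhi := (C1 t0).1 x; rewrite -deriveE//.
have clC : closed C by case: cC.
have dv : h^-1 *: ((Phi t \o shift x) (h *: v) - Phi t x) @[h --> 0^'] -->
    'D_v (Phi t) x by exact: diff_derivable.
refine (closed_cvg _ clC _ _ dv).
near=> h; rewrite /=.
have [h0|h0|h0] := ltgtP h 0;
  last by exfalso; move/eqP: h0; apply/negP; near: h; exact: nbhs_dnbhs_neq.
- rewrite -[h^-1]opprK scaleNr -scalerN opprB.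
  apply: coneZ => //; first by rewrite oppr_ge0 invr_le0 ltW.
  apply: semiflow_mono => //; rewrite opprD addrCA subrr addr0 -scaleNr.
  by apply: coneZ => //; rewrite oppr_ge0 ltW.
- apply: coneZ => //; first by rewrite invr_ge0 ltW.
  apply: semiflow_mono => //; rewrite addrK.
  by apply: coneZ => //; rewrite ltW.
Unshelve. all: by end_near. Qed.

(** * Growth of positive functionals along orbits *)

Context (u : X) (r : R) (r0 : 0 < r).
Context (ur : forall w, `|w| <= r -> C (u + w)).
Context (psi : nat -> {linear X -> R^o}).
Context (psi_le : forall k x, `|psi k x| <= `|x|).
Context (psi_ge0 : forall k x, C x -> 0 <= psi k x).
Context (psi_sep : forall x, (forall k, psi k x = 0) -> x = 0).
Context (t0 : R) (t0_gt0 : 0 < t0).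
Context (orbits : forall x : X, compact (closure (semiflow_orbit Phi x))).
Context (cPhi : forall x : X, compact_operator ('d (Phi t0) x)).

(** The index is shifted so that the time is positive also for [n = 0]. *)
Definition growth k n y : R := psi k ('d (Phi (n.+1%:R * t0)) y u).

Let nt0 n : 0 < n.+1%:R * t0. Proof. by rewrite mulr_gt0. Qed.

Lemma growth_ge0 k n y : 0 <= growth k n y.
Proof.
apply: psi_ge0; apply: semiflow_diff_ge0 => //.
by rewrite -[u]addr0; apply: ur; rewrite normr0 ltW.
Qed.

(** Both [u + w] and [u - w] lie in [C], where [psi k] composed with the derivative is
    nonnegative. *)
Lemma growth_dominates k n y w : `|w| <= r ->
  `|psi k ('d (Phi (n.+1%:R * t0)) y w)| <= growth k n y.
Proof.
move=> wr; rewrite ler_norml; apply/andP; split.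
  rewrite -subr_ge0 opprK addrC -!raddfD; apply/psi_ge0/semiflow_diff_ge0 => //.
  exact: ur.
rewrite -subr_ge0 -!raddfB; apply/psi_ge0/semiflow_diff_ge0 => //.
by apply: ur; rewrite normrN.
Qed.

(** The chain rule splits off the last step [t0], taken at a point of the orbit of [y]; the uniform
    Ehrling inequality holds on the compact orbit closure. *)
Lemma growth_recursion y : exists N, forall n w, `|w| <= r ->
  `|'d (Phi (n.+2%:R * t0)) y w| <=
    2^-1 * `|'d (Phi (n.+1%:R * t0)) y w| + N%:R * \sum_(k < N) growth k n.+1 y.
Proof.
have [N EN] := uniform_ehrling psi_le psi_sep (@orbits y) cPhi (C1 t0_gt0).2.
exists N => n w wr; have := growth_dominates _ n.+1 y wr.
have -> : n.+2%:R * t0 = t0 + n.+1%:R * t0 by rewrite -natr1 mulrDl mul1r addrC.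
rewrite semiflow_diff// => gd /=; apply: le_trans (EN _ _ _) _.
  apply: subset_closure; exists (n.+1%:R * t0) => //=; exact: ltW.
rewrite lerD2l ler_wpM2l//; apply: ler_sum => k _; exact: gd.
Qed.

Lemma growth_bound y (d : R) : 0 <= d ->
  (forall k, \forall n \near \oo, growth k n y <= expR (n%:R * d)) ->
  exists2 c, 0 < c & \forall n \near \oo,
    (opnorm ('d (Phi (n.+1%:R * t0)) y) <= (c * expR (n%:R * d))%:E)%E.
Proof.
move=> d0 gd; have [N rec] := growth_recursion y.
(* The recursion involves only finitely many functionals, so one threshold serves for all. *)
have [n1 gn1] : exists n1, forall n k, (n1 <= n)%N -> (k < N)%N ->
    growth k n y <= expR (n%:R * d).
  elim: N {rec} => [|N [n1 IH]]; first by exists 0%N.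
  have [n2 _ gN] := gd N; exists (maxn n1 n2) => n k.
  rewrite geq_max ltnS [(k <= N)%N]leq_eqVlt => /andP[n1n n2n] /predU1P[->|kN].
    exact: gN.
  exact: IH.
have dL : continuous ('d (Phi (n1.+1%:R * t0)) y).
  by apply: diff_continuous; exact: (C1 _).1.
have [M M0 LM] := linear_lipschitz dL.
(* [r * M] bounds the starting value at [n1], and [B / 2 + N ^ 2 <= B] lets the recursion preserve
   the bound. *)
pose B : R := r * M + 2 * N%:R ^+ 2.
have B0 : 0 < B by rewrite ltr_pwDl ?mulr_gt0// mulr_ge0// exprn_ge0.
have bound n w : `|w| <= r -> (n1 <= n)%N ->
    `|'d (Phi (n.+1%:R * t0)) y w| <= B * expR (n%:R * d).
  move=> wr; elim: n => [|n IH].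
    rewrite leqn0 => /eqP n10; rewrite mul0r expR0 mulr1.
    move: LM; rewrite n10 => /(_ w) /le_trans; apply.
    rewrite mulrC (@le_trans _ _ (r * M)) ?ler_wpM2r ?(ltW M0)//.
    by rewrite /B lerDl mulr_ge0// exprn_ge0.
  rewrite leq_eqVlt => /predU1P[n1E|n1n].
    move: LM; rewrite n1E => /(_ w) /le_trans; apply.
    apply: (@le_trans _ _ B); last first.
      rewrite ler_peMr ?(ltW B0)// -expR0 ler_expR mulr_ge0//.
    rewrite mulrC (@le_trans _ _ (r * M)) ?ler_wpM2r ?(ltW M0)//.
    by rewrite /B lerDl mulr_ge0// exprn_ge0.
  have En : expR (n%:R * d) <= expR (n.+1%:R * d).
    by rewrite ler_expR ler_wpM2r// ler_nat.
  have S : N%:R * \sum_(k < N) growth k n.+1 y <= N%:R ^+ 2 * expR (n.+1%:R * d).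
    rewrite expr2 -mulrA ler_wpM2l// -[N in leRHS]card_ord mulr_natl -sumr_const.
    by apply: ler_sum => k _; apply: gn1 => //; exact: ltnW.
  apply: le_trans (rec _ _ wr) _.
  have := IH n1n; have := ler_wpM2l (ltW B0) En.
  have : 0 <= r * M * expR (n.+1%:R * d) by rewrite !mulr_ge0 ?expR_ge0 ?ltW.
  rewrite /B; move: S; lra.
exists (B / r); first by rewrite divr_gt0.
exists n1 => // n /= n1n; apply: opnorm_le => w w1; rewrite lee_fin.
have := bound n (r *: w) _ n1n; rewrite linearZ !normrZ gtr0_norm//.
rewrite -[X in _ * `|w| <= X]mulr1 ler_wpM2l ?(ltW r0)// => /(_ isT).
by rewrite -ler_pdivlMl// mulrA (mulrC r^-1).
Qed.

(** [q] is the exponent gained per step [t0]. If all functionals eventually grew at most at a rate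
    below [q / 2], [growth_bound] would bound the norms by [c * expR (n%:R * (q / 2))], against the
    lower bound [expR (n.+1%:R * q)]. *)
Lemma chaotic_growth y : chaotic_set Phi y -> exists k m,
  forall n0, exists2 n, (n0 <= n)%N & expR (n%:R / m.+1%:R) < growth k n y.
Proof.
rewrite chaotic_setE => -[m _ chy].
pose q : R := m.+1%:R^-1 * t0.
have q0 : 0 < q by rewrite mulr_gt0 ?invr_gt0.
have [m' m'q] : exists m', (m'.+1%:R^-1 : R) <= q / 2.
  exists (Num.truncn (q / 2)^-1); rewrite invf_ple ?posrE ?divr_gt0//.
  by apply: ltW; rewrite truncnS_gt.
apply: contrapT => /forallNP H.
have [| |c c0 [n1 _ cn]] := @growth_bound y m'.+1%:R^-1; first by rewrite invr_ge0.
  move=> k; have /forallNP/(_ m') := H k; move=> /existsNP[n0 n0P].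
  exists n0 => // n /= n0n; rewrite leNgt; apply/negP => gn.
  by apply: n0P; exists n.
(* The three terms ensure in turn the upper bound on the norm, [m < n.+1 * t0], and
   [c < n.+1 * (q / 2)]. *)
pose n := maxn n1 (maxn (Num.truncn (m%:R / t0)) (Num.truncn (c / (q / 2)))).
have n1n : (n1 <= n)%N by rewrite leq_maxl.
have := cn n n1n; apply/negP; rewrite -ltNge.
apply: (@lt_le_trans _ _ (expR (m.+1%:R^-1 * (n.+1%:R * t0)))%:E); last first.
  apply: chy => /=; rewrite -ltr_pdivrMr//.
  apply: lt_le_trans (truncnS_gt _) _.
  by rewrite ler_nat ltnS /n maxnA maxnAC leq_maxr.
rewrite lte_fin mulrCA -/q.
have cq : c < expR (n.+1%:R * (q / 2)).
  apply: (@lt_le_trans _ _ (n.+1%:R * (q / 2))).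
    rewrite -ltr_pdivrMr ?divr_gt0//; apply: lt_le_trans (truncnS_gt _) _.
    by rewrite ler_nat ltnS /n maxnA leq_maxr.
  by have := expR_ge1Dx (n.+1%:R * (q / 2)); lra.
have -> : n.+1%:R * q = n.+1%:R * (q / 2) + n.+1%:R * (q / 2) by field.
rewrite expRD ltr_pM ?expR_ge0 ?(ltW c0)//.
rewrite ltr_expR; apply: (@le_lt_trans _ _ (n%:R * (q / 2))).
  by rewrite ler_wpM2l.
by rewrite ltr_pM2r ?divr_gt0// ltr_nat.
Qed.

(** * The chaotic set on lines parallel to [u] *)

Lemma psi_continuous k : continuous (psi k).
Proof.
move=> x; apply/cvgrPdist_lt => e e0; near=> y; rewrite -raddfB.
apply: le_lt_trans (psi_le _ _) _; near: y.
by apply: filterS (nbhsx_ballx x e e0) => y; rewrite -ball_normE.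
Unshelve. all: by end_near. Qed.

Lemma growth_continuous k n : continuous (growth k n).
Proof.
move=> x; apply/cvgrPdist_le => e e0.
have e'0 : 0 < e / (`|u| + 1) by rewrite divr_gt0// ltr_wpDl.
near=> y; rewrite distrC /growth -raddfB.
apply: le_trans (psi_le _ _) _.
have yx : (opnorm ('d (Phi (n.+1%:R * t0)) y \- 'd (Phi (n.+1%:R * t0)) x)%R
    <= (e / (`|u| + 1))%:E)%E.
  by near: y; apply: (opnorm_near e'0 ((C1 (nt0 n)).2 x)).
have := opnorm_bound yx u => /= /le_trans; apply.
rewrite mulrAC ler_pdivrMr ?ltr_wpDl// ler_pM2l//; lra.
Unshelve. all: by end_near. Qed.

Lemma growth_is_derive k n x (s : R) :
  is_derive s (1 : R) (fun s => psi k (Phi (n.+1%:R * t0) (x + s *: u)))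
    (growth k n (x + s *: u)).
Proof.
have dP := (C1 (nt0 n)).1 (x + s *: u).
have dpsi y : differentiable (psi k) y.
  by apply: linear_differentiable; exact: psi_continuous.
have -> : growth k n (x + s *: u) =
    'd (psi k \o Phi (n.+1%:R * t0)) (x + s *: u) u.
  by rewrite diff_comp//= diff_lin//; exact: psi_continuous.
exact/is_derive_line/differentiable_comp.
Qed.

Lemma orbit_bounded x : exists M, forall t, 0 <= t -> `|Phi t x| <= M.
Proof.
have [M [_ MP]] := compact_bounded (@orbits x).
exists (M + 1) => t t_ge0; apply: (MP (M + 1)); first by rewrite ltrDl.
by apply: subset_closure; exists t.
Qed.

Lemma chaotic_line_null x :
  @lebesgue_measure R (`[0%R, 1%R] `&` [set s | chaotic_set Phi (x + s *: u)]) = 0%E.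
Proof.
pose E k m n : set R := `[0, 1] `&`
  [set s | expR (n%:R / m.+1%:R) < growth k n (x + s *: u)].
have gc k n : continuous (fun s : R => growth k n (x + s *: u)).
  move=> s; refine (continuous_comp (@line_continuous _ _ x u s) _); exact: growth_continuous.
have mE k m n : measurable (E k m n).
  apply: measurableI => //; apply: open_measurable.
  rewrite (_ : [set s | _] =
    (fun s : R => growth k n (x + s *: u)) @^-1` [set t | expR (n%:R / m.+1%:R) < t])//.
  by apply: open_comp => [s _|]; [exact: gc|exact: open_gt].
have [M0 PM0] := orbit_bounded x; have [M1 PM1] := orbit_bounded (x + u).
have M_ge0 : 0 <= M1 + M0.
  apply: addr_ge0; first exact: le_trans (normr_ge0 _) (PM1 0 (lexx _)).
  exact: le_trans (normr_ge0 _) (PM0 0 (lexx _)).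
(* The integral of [growth k n] along the segment is the increment of [psi k] between the images of
   [x] and [x + u], bounded uniformly in [k] and [n] by the two orbit bounds. *)
have muE k m n : (@lebesgue_measure R (E k m n) <=
    ((M1 + M0) / expR (n%:R / m.+1%:R))%:E)%E.
  apply: le_trans (derivative_markov (expR_gt0 _) (gc k n) _ (growth_is_derive k n x)) _.
    move=> s; exact: growth_ge0.
  rewrite lee_fin ler_pM2r ?invr_gt0 ?expR_gt0// scale1r scale0r addr0 -raddfB.
  apply: le_trans (ler_norm _) _; apply: le_trans (psi_le _ _) _.
  apply: le_trans (ler_normB _ _) _.
  by apply: lerD; [apply: PM1|apply: PM0]; exact: ltW.
have limsup0 k m : @lebesgue_measure R (lim_sup_set (E k m)) = 0%E.
  apply: lim_sup_set_cvg0; first by move=> n; exact: mE.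
  have d0 : 0 < m.+1%:R^-1 :> R by rewrite invr_gt0.
  apply: (@le_lt_trans _ _ ((M1 + M0) / (1 - expR (- m.+1%:R^-1)))%:E); last exact: ltry.
  apply: lime_le; first by apply: is_cvg_nneseries => n _ _; exact: measure_ge0.
  apply: nearW => n; apply: le_trans (lee_sum _ (fun i _ => muE k m i)) _.
  by rewrite sumEFin lee_fin exp_series_le.
have [N [mN N0 EN]] : (@lebesgue_measure R).-negligible
    (\bigcup_k \bigcup_m lim_sup_set (E k m)).
  apply: negligible_bigcup => k; apply: negligible_bigcup => m.
  exists (lim_sup_set (E k m)); split=> //; last exact: limsup0.
  by apply: bigcap_measurable => // n _; apply: bigcup_measurable => i _; exact: mE.
apply: (subset_measure0 _ mN _ N0); last first.
  apply: subset_trans EN => s [s01 /=] /chaotic_growth[k [m km]].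
  by exists k => //; exists m => // n0 _; have [n n0n gn] := km n0; exists n.
apply: measurableI => //.
apply: (@continuous_borel _ _ (fun s => x + s *: u)); first exact: line_continuous.
exact: chaotic_set_borel.
Qed.

(** * Lebesgue outer measure of the chaotic set in finite dimension *)

(* A ball lies in the order interval between two multiples of [u], and so do
   its images under the monotone maps [Phi t]. *)
Lemma ball_orbits_bounded (b : R) : 0 < b -> exists M, forall k n y, `|y| <= b ->
  `|psi k (Phi (n.+1%:R * t0) y)| <= M.
Proof.
move=> b0; have [M1 P1] := orbit_bounded ((b / r) *: u).
have [M2 P2] := orbit_bounded (- ((b / r) *: u)).
exists (M1 + M2) => k n y yb.
have Cb w : `|w| <= b -> C ((b / r) *: u + w).
  move=> wb; have -> : (b / r) *: u + w = (b / r) *: (u + (r / b) *: w).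
    rewrite scalerDr scalerA (_ : b / r * (r / b) = 1) ?scale1r//.
    by field; rewrite !gt_eqF.
  apply: coneZ => //; first by rewrite divr_ge0 ?ltW.
  apply: ur; rewrite normrZ gtr0_norm ?divr_gt0// mulrAC ler_pdivrMr//.
  by rewrite ler_pM2l.
have h1 : C (Phi (n.+1%:R * t0) ((b / r) *: u) - Phi (n.+1%:R * t0) y).
  by apply: semiflow_mono => //; apply: Cb; rewrite normrN.
have h2 : C (Phi (n.+1%:R * t0) y - Phi (n.+1%:R * t0) (- ((b / r) *: u))).
  by apply: semiflow_mono => //; rewrite opprK addrC; exact: Cb.
have := psi_ge0 k h1; have := psi_ge0 k h2; rewrite !raddfB !subr_ge0 => l1 l2.
have n0 := ltW (nt0 n).
have := le_trans (psi_le k _) (P1 _ n0); have := le_trans (psi_le k _) (P2 _ n0).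
have M10 := le_trans (normr_ge0 _) (P1 _ n0).
have M20 := le_trans (normr_ge0 _) (P2 _ n0).
rewrite !ler_norml => /andP[h3 h4] /andP[h5 h6]; move: l1 l2 => /= l1 l2.
by apply/andP; split; lra.
Qed.

Lemma chaotic_image_null d (f : {linear X -> 'rV[R]_d}) : bijective f ->
  lebesgue_outer (f @` chaotic_set Phi) = 0%E.
Proof.
move=> [F fK Fk]; have [K K0 FL] := inverse_lipschitz fK Fk.
have finj := can_inj fK.
move: f F fK Fk FL finj; case: d => [|d] f F fK Fk FL finj.
  (* In dimension 0 all derivatives vanish and no exponent is positive. *)
  suff -> : f @` chaotic_set Phi = set0 by rewrite outer_measure0.
  rewrite -subset0 => z [y chy fy]; move: chy; rewrite chaotic_setE.
  move=> -[m _ /(_ m.+1%:R)] /=; rewrite ltr_nat => /(_ (ltnSn m)).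
  apply/negP; rewrite -ltNge; apply: (@le_lt_trans _ _ 0%E); last first.
    by rewrite lte_fin expR_gt0.
  apply: opnorm_le => w _; rewrite (_ : 'd _ _ w = 0) ?normr0//.
  by apply: finj; apply/rowP => -[].
pose p := f u.
(* If [u] were 0, [C] would contain a ball around 0 and could not be pointed. *)
have [i0 pi0] : exists i, p ord0 i != 0.
  apply: contrapT => /forallNP p0.
  have u0 : u = 0.
    apply: finj; rewrite raddf0; apply/rowP => i; rewrite mxE.
    by apply/eqP/negPn/negP/p0.
  have Cw w : `|w| <= r -> C w by move=> /ur; rewrite u0 add0r.
  pose v := F (delta_mx ord0 ord0).
  have v0 : v != 0.
    apply/eqP => /(congr1 f); rewrite Fk raddf0 => /rowP/(_ ord0).
    by rewrite !mxE !eqxx => /eqP; rewrite oner_eq0.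
  have nv : 0 < `|v| by rewrite normr_gt0.
  have nw : `|(r / `|v|) *: v| <= r.
    by rewrite normrZ gtr0_norm ?divr_gt0// divfK ?gt_eqF.
  have /eqP := cone_anti cC (Cw _ nw) (Cw _ (eq_ind_r (fun t => t <= r) nw (normrN _))).
  by rewrite scaler_eq0 (negbTE v0) orbF gt_eqF// divr_gt0.
pose e0 : 'rV[R]_d.+1 := delta_mx ord0 i0.
(* [L] is the linear map sending [e0] to [p] and fixing the other basis vectors, so that [F \o L]
   carries lines in direction [i0] to lines in direction [u]. *)
pose L (a : 'rV[R]_d.+1) := a + a ord0 i0 *: (p - e0).
pose c := 1 + `|p - e0|.
have c0 : 0 < c by rewrite ltr_pwDl.
have Lc x y : `|L x - L y| <= c * `|x - y|.
  have -> : L x - L y = (x - y) + (x - y) ord0 i0 *: (p - e0).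
    by rewrite /L opprD addrACA -scalerBl !mxE.
  apply: le_trans (ler_normD _ _) _; rewrite mulrDl mul1r lerD2l normrZ mulrC.
  by rewrite ler_wpM2l// rV_norm_ge.
have LE a (s : R) : F (L (a + s *: e0)) = F (L a) + s *: u.
  apply: finj; rewrite Fk linearD linearZ/= Fk -/p /L.
  rewrite 3!mxE !eqxx mulr1 scalerDl addrACA -scalerDr.
  by rewrite [e0 + _]addrC subrK.
have Lsurj z : exists a, L a = z.
  (* The coordinate [i0] of [L a] is [a ord0 i0 * p ord0 i0], which determines [a ord0 i0] and then
     [a]. *)
  exists (z - (z ord0 i0 / p ord0 i0) *: (p - e0)); rewrite /L.
  set s := _ / _; have -> : (z - s *: (p - e0)) ord0 i0 = s.
    rewrite !mxE !eqxx /s /=; field; exact: pi0.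
  by rewrite subrK.
have FLn a : `|F (L a)| <= K * c * `|a|.
  have F0 : F (L 0) = 0.
    by apply: finj; rewrite Fk raddf0 /L mxE scale0r addr0.
  have := FL (L a) (L 0); rewrite F0 subr0 => /le_trans; apply.
  by rewrite -mulrA ler_wpM2l ?(ltW K0)//; have := Lc a 0; rewrite subr0.
have FLc : continuous (F \o L).
  apply: (lipschitz_map_continuous (mulr_gt0 K0 c0)) => a b.
  by apply: le_trans (FL _ _) _; rewrite -mulrA ler_wpM2l ?(ltW K0).
pose g k n (a : 'rV[R]_d.+1) := growth k n (F (L a)).
(* The balls of radius [B.+1] exhaust the space; [k] and [m] are those of [chaotic_growth]. *)
pose E (B k m n : nat) := L @` [set a | (`|a| <= B.+1%:R)%R /\ (expR (n%:R / m.+1%:R) < g k n a)%R].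
have null B k m : lebesgue_outer (lim_sup_set (E B k m)) = 0%E.
  have KB0 : 0 < K * c * B.+1%:R by rewrite !mulr_gt0.
  have [M PM] := ball_orbits_bounded KB0.
  have M0 : 0 <= M.
    have h : `|0 : X| <= K * c * B.+1%:R by rewrite normr0 ltW.
    exact: le_trans (normr_ge0 _) (PM 0%N 0%N 0 h).
  pose A : R := (2 * B.+1%:R) ^+ d * (2 * c) ^+ d.+1.
  have A0 : 0 <= A by apply: mulr_ge0; apply: exprn_ge0; rewrite mulr_ge0// ltW.
  have En n : (lebesgue_outer (E B k m n) <=
      ((A * (4 * M)) / expR (n%:R / m.+1%:R))%:E)%E.
    rewrite -mulrA; apply: (@directional_measure_bound R d i0 L c B.+1%:R M _
      (fun a => psi k (Phi (n.+1%:R * t0) (F (L a)))) (g k n)) => //.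
    - move=> a; apply: (@continuous_comp _ _ _ (F \o L) (growth k n)).
        exact: FLc.
      exact: growth_continuous.
    - by move=> a; exact: growth_ge0.
    - move=> a aB; apply: PM; apply: le_trans (FLn a) _.
      by rewrite ler_wpM2l// mulr_ge0 ?ltW.
    - move=> a s; rewrite /g LE.
      rewrite (_ : (fun s => _) = fun s : R => psi k (Phi (n.+1%:R * t0) (F (L a) + s *: u))).
        exact: growth_is_derive.
      by apply/funext => s'; rewrite LE.
  apply: outer_lim_sup_set0.
  have AM : 0 <= A * (4 * M) by apply: mulr_ge0 => //; exact: mulr_ge0.
  have d0 : 0 < m.+1%:R^-1 :> R by rewrite invr_gt0.
  apply: (@le_lt_trans _ _ ((A * (4 * M)) / (1 - expR (- m.+1%:R^-1)))%:E); last exact: ltry.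
  apply: lime_le; first by apply: is_cvg_nneseries => n _ _; exact: outer_measure_ge0.
  apply: nearW => n; apply: le_trans (lee_sum _ (fun i _ => En i)) _.
  by rewrite sumEFin lee_fin exp_series_le.
apply/eqP; rewrite eq_le outer_measure_ge0 andbT.
have <- : lebesgue_outer (\bigcup_B \bigcup_k \bigcup_m lim_sup_set (E B k m)) = 0%E.
  apply: countable_union_null => B; apply: countable_union_null => k.
  by apply: countable_union_null => m; exact: null.
apply: le_outer_measure => _ [y chy <-].
have [a La] := Lsurj (f y).
have [k [m km]] := chaotic_growth chy.
exists (Num.truncn `|a|) => //; exists k => //; exists m => // n0 _.
have [n n0n gn] := km n0; exists n => //; exists a => //; split.
  exact/ltW/truncnS_gt.
by rewrite /g La fK.
Qed.

End ChaoticSetNull.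

(* X = R^d is expressed by a linear bijection f from X onto the row vectors:
   this allows an arbitrary norm on R^d. *)
Theorem theoremC (R : realType) (X : completeNormedModType R) (C : set X)
    (Phi : R -> X -> X) (t0 : R) :
  separable_space X ->
  strongly_ordered C ->
  is_semiflow Phi ->
  C1_smooth Phi ->
  strongly_monotone C Phi ->
  (forall x : X, compact (closure (semiflow_orbit Phi x))) ->
  0 < t0 ->
  (forall x : X, compact_operator ('d (Phi t0) x)) ->
  (forall e : X, equilibrium Phi e -> strongly_positive C ('d (Phi t0) e)) ->
  shy (chaotic_set Phi) /\
  (forall (d : nat) (f : {linear X -> 'rV[R]_d}), bijective f ->
     lebesgue_null (f @` chaotic_set Phi) /\ ~ observable_chaos f Phi).
Proof.
move=> sepX [cC [u /nbhs_ballP[r /= r0 rC]]] sfPhi C1 mPhi orbits t0_gt0 cPhi _.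
have [psi [psi_le psi_ge0 psi_sep]] := separating_positive_functionals sepX cC.
(* Halving the radius replaces the open ball around [u] by a closed one. *)
have r20 : 0 < r / 2 by rewrite divr_gt0.
have ur w : `|w| <= r / 2 -> C (u + w).
  move=> wr; apply: rC; rewrite -ball_normE/= opprD addrA subrr add0r normrN; lra.
split=> [|d f fbij].
  apply: (@shy_segment _ _ u); first exact: chaotic_set_borel.
  exact: (chaotic_line_null cC sfPhi C1 mPhi r20 ur psi_le psi_ge0 psi_sep
    t0_gt0 orbits cPhi).
have f0 := chaotic_image_null cC sfPhi C1 mPhi r20 ur psi_le psi_ge0 psi_sep
  t0_gt0 orbits cPhi fbij.
split; first exact: lebesgue_outer_null.
move=> [A [_ + AC]]; apply/negP; rewrite -leNgt -f0.
by apply: le_outer_measure; exact: image_subset.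
Qed.
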